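(* Let $A_1,\dots,A_k$ be $2\times2$ real matrices with all entries strictly positive and norm $<1$, $d_i\in\mathbb R^2$, $T_i(x)=A_ix+d_i$, with $T_i(D)\subset D$ for all $i$ ($D$ the closed unit disc). Let $\mu$ be a Bernoulli measure on $\Sigma=\{1,\dots,k\}^{\mathbb N}$, fix $\theta\in\mathbb{PR}^1$ and $C\in\mathbb R$. Suppose that for $\mu$-almost every $\underline a\in\Sigma$, \[ \lim_{N\to\infty}\liminf_{n\to\infty}\frac{1}{N\log 2}\,\frac1n\sum_{i=1}^n H_{2^{-(i+1)N}}\big(\pi_\theta(\mu_{[a_1\cdots a_{n_i}]})\big)\ \ge\ C, \] where $n_i=n_i(\underline a,N,\theta)$. Then $\dim_H\pi_\theta(\mu)\ge C$.
   Context: $\Sigma=\{1,\dots,k\}^{\mathbb N}$, with cylinders $[a_1\cdots a_n]=\{\underline b\in\Sigma:b_j=a_j, j\le n\}$. A Bernoulli measure is a product measure $p^{\mathbb N}$. The coding map $\Pi:\Sigma\to D$ sends $\underline a$ to $\bigcap_n D_{a_1\cdots a_n}$, where $D_w=T_{a_1}\circ\cdots\circ T_{a_n}(D)$ for $w=a_1\cdots a_n$. For $\theta\in\mathbb{PR}^1$ (lines through the origin), $\pi_\theta$ is orthogonal projection of $D$ onto the diameter of $D$ perpendicular to $\theta$, identified isometrically with $[-1,1]$; for a measure $\nu$ on $\Sigma$, $\pi_\theta(\nu)$ denotes the push-forward under $\pi_\theta\circ\Pi$. $\mu_{[w]}=\mu|_{[w]}/\mu([w])$. The length function is $|w|_\theta=-\log_2(|\pi_\theta(D_w)|/2)$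 (interval length), with $|\emptyset|_\theta=0$; it is strictly increasing along $a_1,a_1a_2,\dots$ and tends to infinity. For $\underline a\in\Sigma$, $N,j\in\mathbb N$, $n_j=n_j(\underline a,N,\theta)$ is the natural number with $|a_1\cdots a_{n_j-1}|_\theta<Nj\le|a_1\cdots a_{n_j}|_\theta$. For a probability measure $\nu$ on $[-1,1]$ and $r>0$, the $r$-scale entropy is $H_r(\nu)=-\int\log\nu(B_r(x))\,d\nu(x)$ (natural logarithm). $\dim_H\nu=\inf\{\dim_H U:\nu(U^c)=0\}$. *)

(* Defs.v *)
From HB Require Import structures.
From mathcomp Require Import all_boot all_order all_algebra.
From mathcomp Require Import all_classical all_reals all_analysis.
Set Implicit Arguments. Unset Strict Implicit. Unset Printing Implicit Defensive.
Import Order.TTheory GRing.Theory Num.Theory.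
Import numFieldNormedType.Exports.
Local Open Scope classical_set_scope.
Local Open Scope ring_scope.

(* the alphabet {1,...,k} is 'I_k.-1.+1, which is 'I_k whenever 0 < k *)
Definition Sym (k : nat) := 'I_k.-1.+1.
Definition Seqs (k : nat) := nat -> Sym k.
HB.instance Definition _ k := gen_eqMixin (Seqs k).
HB.instance Definition _ k := gen_choiceMixin (Seqs k).
HB.instance Definition _ k := isPointed.Build (Seqs k) (fun _ => ord0).

(* the word a_1 ... a_n (sequences are indexed from 0: a_1 = a 0) *)
Definition prefix k (a : Seqs k) (n : nat) : seq (Sym k) := mkseq a n.

Definition cyl k (w : seq (Sym k)) : set (Seqs k) :=
  [set a | prefix a (size w) = w].
Definition cylinders k : set (set (Seqs k)) := [set cyl w | w in [set: seq (Sym k)]].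

(* Sigma with the sigma-algebra generated by cylinders (= Borel sets of the product topology) *)
Definition Sigma k := g_sigma_algebraType (@cylinders k).

(* Bernoulli measure p^N : determined by its values on cylinders *)
Definition bernoulli_measure (R : realType) k (mu : set (Sigma k) -> \bar R) :=
  exists p : Sym k -> R, (forall i, 0 <= p i) /\ \sum_(i : Sym k) p i = 1 /\
    forall w : seq (Sym k), mu (cyl w) = (\prod_(i <- w) p i)%:E.

Definition condm (R : realType) k (mu : set (Sigma k) -> \bar R) (w : seq (Sym k))
  : set (Sigma k) -> \bar R :=
  fun B => (mu (B `&` cyl w) * ((fine (mu (cyl w)))^-1)%:E)%E.

Section Plane.
Variable R : realType.

Definition c0 : 'I_2 := ord0.
Definition c1 : 'I_2 := ord_max.

Definition enorm (x : 'cV[R]_2) : R := Num.sqrt (x c0 ord0 ^+ 2 + x c1 ord0 ^+ 2).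

Definition opnorm (A : 'M[R]_2) : R :=
  sup [set enorm (A *m x) | x in [set x : 'cV[R]_2 | enorm x <= 1]].

Definition disc : set 'cV[R]_2 := [set x | enorm x <= 1].

Variable k : nat.
Variables (A : Sym k -> 'M[R]_2) (d : Sym k -> 'cV[R]_2).

Definition Tmap (i : Sym k) (x : 'cV[R]_2) : 'cV[R]_2 := A i *m x + d i.

Definition Tw (w : seq (Sym k)) (x : 'cV[R]_2) : 'cV[R]_2 := foldr Tmap x w.

Definition Dw (w : seq (Sym k)) : set 'cV[R]_2 := Tw w @` disc.

Definition coding (a : Seqs k) : 'cV[R]_2 :=
  xget 0 [set x | forall n, Dw (prefix a n) x].

(* theta in PR^1 is given by a unit vector e spanning the line theta;
   pi_theta(x) = <x, e^perp> with e^perp = (-e_2, e_1): orthogonal projection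
   onto the diameter perpendicular to theta, identified isometrically with [-1,1] *)
Definition pitheta (e : 'cV[R]_2) (x : 'cV[R]_2) : R :=
  e c0 ord0 * x c1 ord0 - e c1 ord0 * x c0 ord0.

Definition plen (e : 'cV[R]_2) (S : set 'cV[R]_2) : \bar R :=
  ereal_sup [set (`|pitheta e x.1 - pitheta e x.2|)%:E | x in S `*` S].

Definition wlen (e : 'cV[R]_2) (w : seq (Sym k)) : \bar R :=
  let L := fine (plen e (Dw w)) in
  if 0 < L then (- (ln (L / 2) / ln 2))%:E else +oo%E.

Definition nj (e : 'cV[R]_2) (a : Seqs k) (N j : nat) : nat :=
  xget 0%N [set n : nat | (wlen e (prefix a n.-1) < ((N * j)%:R)%:E)%E /\
                          (((N * j)%:R)%:E <= wlen e (prefix a n))%E].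

End Plane.

Section OnLine.
Variable R : realType.
Local Open Scope ereal_scope.

Definition entropy (r : R) (nu : set R -> \bar R) : \bar R :=
  \int[nu]_x (if nu (ball x r) == 0 then +oo
              else (- ln (fine (nu (ball x r))))%:E).

Definition ediam (U : set R) : \bar R :=
  ereal_sup [set (`|x.1 - x.2|)%:E | x in U `*` U].

Definition cterm (s : R) (U : set R) : \bar R :=
  if `[< U = set0 >] then 0 else ((fine (ediam U)) `^ s)%:E.

Definition hcontent (s delta : R) (U : set R) : \bar R :=
  ereal_inf [set \sum_(0 <= j <oo) cterm s (F j) |
     F in [set F : nat -> set R |
             U `<=` \bigcup_j F j /\ forall j, ediam (F j) <= delta%:E]].

Definition hmeasure (s : R) (U : set R) : \bar R :=
  ereal_sup [set hcontent s delta U | delta in [set delta : R | (0 < delta)%R]].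

Definition hdim (U : set R) : \bar R :=
  ereal_inf [set s%:E | s in [set s : R | (0 <= s)%R /\ hmeasure s U = 0]].

Definition mdim (nu : set R -> \bar R) : \bar R :=
  ereal_inf [set hdim U | U in [set U : set R | measurable U /\ nu (~` U) = 0]].

End OnLine.

Definition avg_entropy (R : realType) k (A : Sym k -> 'M[R]_2) (d : Sym k -> 'cV[R]_2)
  (mu : set (Sigma k) -> \bar R) (e : 'cV[R]_2) (a : Seqs k) (N n : nat) : \bar R :=
  (((N%:R * ln (2 : R))^-1)%:E * ((n%:R^-1)%:E *
     \sum_(1 <= i < n.+1)
        entropy (((2 : R)^-1) ^+ (i.+1 * N))
          (pushforward (condm mu (prefix a (nj A d e a N i)))
             (fun b : Sigma k => pitheta e (coding A d b)))))%E.

(* Main.v *)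
(** Write y(b) for the projected point of the sequence b, and fix N.  Along the
    branch of b, let w_j be the word a_1 ... a_(n_j), let q_j be the conditional mass,
    given w_j, of the 2^(-N(j+1))-cell of the point attached to w_(j+1), and let h_j
    be the conditional mean of - ln q_j given w_j, which is the entropy of the
    statement up to O(1).  If V_n denotes the mass of a neighbourhood of the cell of
    b at scale 2^(-Nn), backward induction over the words gives
      E [V_n / (q_1 ... q_(n-1))] <= K^n,
      E [prod_j (q_j e^(h_j))^t] <= (1 + tau^2)^n   with t of order tau / N,
    K being absolute.  By Markov's inequality and the Borel-Cantelli lemma, almost
    surely and for all large n, - ln V_n >= sum_j h_j - n (O(1) + O(tau N)).  Since
    the loss is small compared to n N once tau is small and N is large, the hypothesis
    bounds the mass of small balls around almost every projected point by r^(C - eps),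
    and the mass distribution principle yields the bound on the dimension. *)

From Pilot Require Import Defs.
From HB Require Import structures.
From mathcomp Require Import all_boot all_order all_algebra.
From mathcomp Require Import all_classical all_reals all_analysis.
From mathcomp Require Import measurable_realfun ring lra zify.
Import Order.TTheory GRing.Theory Num.Theory.
Import numFieldNormedType.Exports.
(* Imported again so that [prefix] is the one of Defs and not [seq.prefix]. *)
Import Pilot.Defs.
Set Implicit Arguments. Unset Strict Implicit. Unset Printing Implicit Defensive.
Local Open Scope ring_scope.

(** * Conditional frequencies along a finite tree *)

(** Squaring [exp(-u/2) >= 1 - u/2 > 0] gives [exp u * (1 - u/2)^2 <= 1], whereas
    [(1 + u + u^2) * (1 - u/2)^2 >= 1] as soon as [1 - 3 u >= 0]; hence the bound [3^-1]. *)
Lemma expR_le_quadratic (R : realType) (u : R) : `|u| <= 3^-1 ->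
  expR u <= 1 + u + u ^+ 2.
Proof.
rewrite ler_norml => /andP[u1 u2].
have /= h := expR_ge1Dx (- (u / 2)).
have e1 : expR u * expR (- (u / 2)) ^+ 2 = 1.
  rewrite -expRM_natl -expRD -(expR0 R); congr expR.
  by field.
have h2 : (1 - u / 2) ^+ 2 <= expR (- (u / 2)) ^+ 2.
  by rewrite ler_sqr// ?nnegrE//; lra.
have h3 : expR u * (1 - u / 2) ^+ 2 <= 1.
  by rewrite -[leRHS]e1; apply: ler_wpM2l => //; exact: expR_ge0.
have h4 : 1 <= (1 + u + u ^+ 2) * (1 - u / 2) ^+ 2.
  have -> : (1 + u + u ^+ 2) * (1 - u / 2) ^+ 2 =
    1 + u ^+ 2 * ((1 - 3 * u + u ^+ 2) / 4) by field.
  rewrite lerDl mulr_ge0// ?sqr_ge0//; have := sqr_ge0 u; lra.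
rewrite -(ler_pM2r (_ : 0 < (1 - u / 2) ^+ 2)) ?exprn_gt0//; last by lra.
exact: le_trans h3 h4.
Qed.

Lemma sum_window_le (R : realType) (V : finType) (p : pred V) (k : V -> int)
    (c : int) (L : nat) (F : V -> R) (K : R) :
  (forall v, 0 <= F v) ->
  (forall j, \sum_(v | p v && (k v == j)) F v <= K) ->
  \sum_(v | p v && (`|k v - c| <= L)%N) F v <= L.*2.+1%:R * K.
Proof.
move=> F0 FK.
apply: (@le_trans _ _ (\sum_(v | p v) \sum_(j < L.*2.+1 | k v == c - L%:Z + j%:Z) F v)).
  rewrite big_mkcondr/= ler_sum// => v pv; case: ifPn => kv.
    have jlt : (`|(k v - (c - L%:Z))%R| < L.*2.+1)%N by lia.
    rewrite (bigD1 (Ordinal jlt))/=; last by apply/eqP; lia.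
    by rewrite lerDl sumr_ge0.
  by rewrite sumr_ge0.
rewrite (exchange_big_dep xpredT)//= -[L.*2.+1 in leRHS]card_ord -mulr_natl.
rewrite mulr_natl mulr_natl -sumr_const ler_sum// => j _; exact: FK.
Qed.

(** Carries a product over earlier levels, constant on the fibres of [X], through an estimate known
    on each fibre. *)
Lemma sum_fibers_le (R : realType) (V : finType) (T : eqType) (X : V -> T)
    (f psi chi : V -> R) :
  (forall v, 0 <= f v) -> (forall u v, X u = X v -> f u = f v) ->
  (forall u, \sum_(v | X v == X u) psi v <= \sum_(v | X v == X u) chi v) ->
  \sum_v f v * psi v <= \sum_v f v * chi v.
Proof.
(* [T] need not be finite, so a fibre is indexed by the subset of [V] that it forms. *)
move=> f0 fX le; pose cls v := [set u | X u == X v].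
have clsE u v : (cls v == cls u) = (X v == X u).
  apply/eqP/eqP => [e|e]; last by apply/finset.setP => w; rewrite !inE e.
  by have := congr1 (fun S : {set V} => v \in S) e; rewrite !inE eqxx => /esym/eqP.
rewrite (partition_big cls predT)//= [leRHS](partition_big cls predT)//= ler_sum// => S _.
case: (pickP [pred u | cls u == S]) => [u /eqP <-|nS]; last first.
  by rewrite !big_pred0// => v; have := nS v.
have E F : \sum_(i | cls i == cls u) f i * F i = f u * \sum_(i | X i == X u) F i.
  rewrite mulr_sumr; apply: eq_big => [v|v]; first exact: clsE.
  by rewrite clsE => /eqP /fX ->.
by rewrite !E ler_wpM2l.
Qed.

Section finite_tree.
Variables (R : realType) (V : finType) (P : V -> R).
Hypothesis P0 : forall v, 0 <= P v.
Hypothesis P1 : \sum_v P v = 1.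

Section one_class.
Variable p : pred V.

(** The denominator is constant on the cell [c], so the sum is [A / (A / Q + a)] with [A] the mass
    of the cell, and [A] cancels. *)
Lemma sum_div_freq_le (k : V -> int) (c : int) (a : R) : 0 <= a ->
  forall Q, Q = \sum_(u | p u) P u ->
  \sum_(v | p v && (k v == c))
     P v / ((\sum_(u | p u && (k u == k v)) P u) / Q + a) <= Q.
Proof.
move=> a0 Q QE.
have Q0 : 0 <= Q by rewrite QE sumr_ge0.
set A := \sum_(u | p u && (k u == c)) P u.
have A0 : 0 <= A by rewrite sumr_ge0.
have AQ : A <= Q by rewrite QE (bigID (fun u => k u == c))/= lerDl sumr_ge0.
rewrite (eq_bigr (fun v => P v / (A / Q + a))); last by move=> v /andP[_ /eqP ->].
rewrite -mulr_suml -/A.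
have [->|A1] := eqVneq A 0; first by rewrite !mul0r.
have Ap : 0 < A by rewrite lt_def A1.
have Qp : 0 < Q := lt_le_trans Ap AQ.
have D0 : 0 < A / Q by rewrite divr_gt0.
rewrite ler_pdivrMr ?ltr_wpDr// mulrDr mulrCA divff ?gt_eqF// mulr1.
by rewrite lerDl mulr_ge0.
Qed.

End one_class.

Variable T : eqType.
Implicit Types (X : V -> T) (k : V -> int).

Definition class_mass X v := \sum_(u | X u == X v) P u.

Definition freq X k v := (\sum_(u | (X u == X v) && (k u == k v)) P u) / class_mass X v.

Definition class_mean X (f : V -> R) v :=
  (\sum_(u | X u == X v) P u * f u) / class_mass X v.

(** The radius 5 is large enough to cover a ball ([cell_near]) and is preserved when passing to a
    coarser scale ([cell_coarsen]). *)
Definition near_mass k v := \sum_(u | (`|k u - k v| <= 5)%N) P u.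

Lemma class_mass_ge0 X v : 0 <= class_mass X v.
Proof. exact: sumr_ge0. Qed.

Lemma freq_ge0 X k v : 0 <= freq X k v.
Proof. by rewrite divr_ge0// ?class_mass_ge0// sumr_ge0. Qed.

Lemma freq_le1 X k v : freq X k v <= 1.
Proof.
have : \sum_(u | (X u == X v) && (k u == k v)) P u <= class_mass X v.
  by rewrite [leRHS](bigID (fun u => k u == k v))/= lerDl sumr_ge0.
have [e|ne] := eqVneq (class_mass X v) 0; first by rewrite /freq e invr0 mulr0.
by rewrite ler_pdivrMr ?mul1r// lt_def ne class_mass_ge0.
Qed.

Lemma freq_gt0 X k v : 0 < P v -> 0 < freq X k v.
Proof.
move=> Pv; rewrite divr_gt0//.
  by rewrite (bigD1 v)/= ?eqxx// ltr_wpDr// sumr_ge0.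
by rewrite /class_mass (bigD1 v)/= ?eqxx// ltr_wpDr// sumr_ge0.
Qed.

Lemma freq_class X k u v : X u = X v -> k u = k v -> freq X k u = freq X k v.
Proof. by rewrite /freq /class_mass => -> ->. Qed.

Lemma class_mean_class X f u v : X u = X v -> class_mean X f u = class_mean X f v.
Proof. by rewrite /class_mean /class_mass => ->. Qed.

Lemma sum_class_mean X f u :
  \sum_(v | X v == X u) P v * class_mean X f v = \sum_(v | X v == X u) P v * f v.
Proof.
under eq_bigr => v /eqP e do rewrite (class_mean_class f e).
rewrite -mulr_suml /class_mean -/(class_mass X u).
have [e|ne] := eqVneq (class_mass X u) 0; last by rewrite mulrCA divff ?mulr1.
rewrite e mul0r big1// => v Xv; apply/eqP; rewrite mulf_eq0; apply/orP; left.
by move: e => /eqP; rewrite psumr_eq0// => /allP/(_ v); rewrite mem_index_enum Xv => /(_ isT).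
Qed.

Lemma class_mean_le X f c v : 0 <= c -> (forall u, f u <= c) -> class_mean X f v <= c.
Proof.
move=> c0 fc; have [e|ne] := eqVneq (class_mass X v) 0.
  by rewrite /class_mean e invr0 mulr0.
rewrite ler_pdivrMr ?lt_def ?ne ?class_mass_ge0// mulrC mulr_suml ler_sum// => u _.
by rewrite ler_wpM2l.
Qed.

Lemma class_meanN X f v : class_mean X (fun u => - f u) v = - class_mean X f v.
Proof.
by rewrite /class_mean -mulNr -sumrN; congr (_ / _); apply: eq_bigr => u _; rewrite mulrN.
Qed.

(* Summing [P v / freq] over a fibre of [X] counts the values of [k1] on it
   without weights, so the factor [11] only reflects the overlap of the windows. *)
Lemma near_mass_step X k0 k1 a : 0 <= a ->
  (forall u v, X u = X v -> k0 u = k0 v) ->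
  (forall u v, (`|k1 u - k1 v| <= 5)%N -> (`|k0 u - k0 v| <= 5)%N) ->
  forall u, \sum_(v | X v == X u) P v * (near_mass k1 v / (freq X k1 v + a)) <=
            \sum_(v | X v == X u) P v * (11 * near_mass k0 v).
Proof.
move=> a0 Xk0 kk u.
have -> : \sum_(v | X v == X u) P v * (11 * near_mass k0 v) =
    \sum_(w | (`|k0 w - k0 u| <= 5)%N) P w * (11 * class_mass X u).
  under eq_bigr => v /eqP e do rewrite /near_mass (Xk0 _ _ e).
  by rewrite -!mulr_suml -/(near_mass k0 u) /class_mass; ring.
under eq_bigr => v _ do rewrite /near_mass mulrCA mulr_suml.
rewrite (exchange_big_dep xpredT)//=.
(* A leaf [w] close to some member of the fibre at the fine scale is close to the common value of
   [k0] on that fibre, so all other [w] contribute nothing. *)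
rewrite (bigID (fun w => (`|k0 w - k0 u| <= 5)%N))/=.
rewrite [X in _ + X]big1 ?addr0 => [|w nw]; last first.
  rewrite big_pred0// => v; apply/negbTE/negP => /andP[/eqP e /kk].
  by rewrite (Xk0 _ _ e) (negbTE nw).
rewrite ler_sum// => w _; rewrite -mulr_sumr ler_wpM2l//.
pose q v := P v / ((\sum_(x | (X x == X u) && (k1 x == k1 v)) P x) / class_mass X u + a).
rewrite (eq_bigr q) => [|v /andP[/eqP e _]]; last by rewrite /q /freq /class_mass e.
rewrite (eq_bigl (fun v => (X v == X u) && (`|k1 v - k1 w| <= 5)%N)) => [|v]; last first.
  by rewrite distnC.
apply: (@sum_window_le _ _ (fun v => X v == X u)) => [v|j].
  by rewrite divr_ge0// addr_ge0// divr_ge0 ?class_mass_ge0 ?sumr_ge0.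
by apply: (@sum_div_freq_le (fun v => X v == X u)).
Qed.

Section smoothed.
Variable m : R.
Hypothesis m1 : 1 <= m.

(* The smoothing term [m^-1] keeps the logarithm within [ln (2 * m)] of [0]; with
   [m] comparable to the number of cells it changes the entropy by [O(1)] only. *)
Definition log_freq X k v := ln (freq X k v + m^-1).

Let m0 : 0 < m. Proof. exact: lt_le_trans m1. Qed.

Let q0 X k v : 0 < freq X k v + m^-1.
Proof. by rewrite ltr_wpDl ?freq_ge0 ?invr_gt0. Qed.

Lemma log_freq_le X k v : log_freq X k v <= ln 2.
Proof.
rewrite ler_ln ?posrE//; have : m^-1 <= 1 by rewrite invf_le1.
have := freq_le1 X k v; lra.
Qed.

Lemma log_freq_ge X k v : - ln m <= log_freq X k v.
Proof. by rewrite -lnV ?posrE// ler_ln ?posrE ?invr_gt0// lerDr freq_ge0. Qed.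

(** The exponent has mean zero on each fibre, and modulus at most [tau] because [log_freq] lies
    between [- ln m] and [ln 2]. The linear term of [expR_le_quadratic] therefore vanishes after
    summation. *)
Lemma exp_moment_step X k tau : 0 <= tau <= 3^-1 ->
  let t := tau / ln (2 * m) in
  forall u, \sum_(v | X v == X u)
       P v * expR (t * (class_mean X (fun w => - log_freq X k w) v + log_freq X k v)) <=
     \sum_(v | X v == X u) P v * (1 + tau ^+ 2).
Proof.
move=> /andP[tau0 tau1] t u.
have B0 : 0 < ln (2 * m) by rewrite ln_gt0 //; have := m1; lra.
have ln2 : 0 <= ln 2 :> R by rewrite ln_ge0; lra.
have lnm : 0 <= ln m by rewrite ln_ge0.
set z := fun v => class_mean X (fun w => - log_freq X k w) v + log_freq X k v.
have zB v : `|z v| <= ln (2 * m).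
  rewrite lnM ?posrE// /z class_meanN ler_norml.
  have h1 := log_freq_le X k v; have h2 := log_freq_ge X k v.
  have h3 := class_mean_le X v ln2 (log_freq_le X k).
  have : class_mean X (fun w => - log_freq X k w) v <= ln m.
    by apply: class_mean_le => // w; rewrite lerNl log_freq_ge.
  rewrite class_meanN.
  by move=> h4; apply/andP; split; lra.
have tz v : `|t * z v| <= tau.
  rewrite /t normrM ger0_norm ?divr_ge0 ?(ltW B0)// mulrAC ler_pdivrMr//.
  by rewrite ler_wpM2l.
have mean0 : \sum_(v | X v == X u) P v * (t * z v) = 0.
  under eq_bigr do rewrite /z class_meanN mulrCA mulrDr mulrN.
  by rewrite -mulr_sumr big_split/= sumrN sum_class_mean addNr mulr0.
rewrite [leRHS](_ : _ = \sum_(v | X v == X u) P v * (1 + tau ^+ 2) +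
  \sum_(v | X v == X u) P v * (t * z v)); last by rewrite mean0 addr0.
rewrite -big_split/= ler_sum// => v _.
rewrite -mulrDr ler_wpM2l//; apply: le_trans (expR_le_quadratic _) _.
  exact: le_trans (tz v) tau1.
rewrite addrAC lerD2r lerD2l -real_normK ?num_real//.
have h := tz v; rewrite ler_sqr ?nnegrE//.
Qed.

(** By [ln y <= y], the difference of the entropies is at most the mean of
    [(freq k + m^-1) / freq J]. A cell of [k] meets at most 11 cells of [J], which bounds the first
    part by 11; [J] takes at most [m] values on a fibre, which bounds the second part by 1. *)
Lemma class_entropy_le X k (J : V -> int) (D : nat) : m = D.*2.+1%:R ->
  (forall v, (`|J v - k v *+ 2| <= 5)%N) ->
  (forall u v, X u = X v -> (`|J u - J v| <= D)%N) ->
  forall v, class_mean X (fun u => - ln (freq X J u)) v <=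
            class_mean X (fun u => - log_freq X k u) v + 12.
Proof.
move=> mE Jk JD v.
have [e|ne] := eqVneq (class_mass X v) 0.
  by rewrite /class_mean e invr0 !mulr0 add0r.
have Q0 : 0 < class_mass X v by rewrite lt_def ne class_mass_ge0.
rewrite -(ler_pM2r Q0) mulrDl !divfK//.
have key : \sum_(u | X u == X v) P u * ((freq X k u + m^-1) / freq X J u) <=
    12 * class_mass X v.
  pose g u := P u / ((\sum_(x | (X x == X v) && (J x == J u)) P x) / class_mass X v + 0).
  have gE u : X u = X v -> P u / freq X J u = g u.
    by move=> e; rewrite /g addr0 /freq /class_mass e.
  have g0 u : 0 <= g u.
    by rewrite /g addr0 divr_ge0// divr_ge0 ?class_mass_ge0 ?sumr_ge0.
  have gj j : \sum_(u | (X u == X v) && (J u == j)) g u <= class_mass X v.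
    by apply: (@sum_div_freq_le (fun u => X u == X v)).
  under eq_bigr => u /eqP e do rewrite mulrCA mulrC (gE _ e) mulrDr.
  rewrite big_split/= (_ : 12 * _ = 11 * class_mass X v + class_mass X v); last by ring.
  rewrite lerD//.
    apply: (@le_trans _ _ (\sum_(x | X x == X v) P x / class_mass X v *
        \sum_(u | (X u == X v) && (`|J u - k x *+ 2| <= 5)%N) g u)).
      under eq_bigr => u /eqP e.
        rewrite /freq [class_mass X u]/class_mass e mulrA mulr_sumr mulr_suml.
        over.
      rewrite /= (exchange_big_dep (fun x => X x == X v))/=; last by move=> ? ? _ /andP[].
      rewrite ler_sum// => x xv; rewrite mulr_sumr [leRHS]big_mkcond/= [leLHS]big_mkcond/=.
      rewrite ler_sum// => u _.
      case: (X u == X v) => //=; case: (eqVneq (k x) (k u)) => [->|_].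
        by rewrite xv Jk -/(class_mass X v) -mulrA mulrC.
      by rewrite andbF; case: ifP => // _; rewrite mulr_ge0// divr_ge0// class_mass_ge0.
    apply: (@le_trans _ _ (\sum_(x | X x == X v) P x / class_mass X v * (11 * class_mass X v))).
      rewrite ler_sum// => x _; rewrite ler_wpM2l ?divr_ge0 ?class_mass_ge0//.
      exact: sum_window_le.
    by rewrite -!mulr_suml -/(class_mass X v) divff// mul1r.
  rewrite -mulr_suml ler_pdivrMr// mulrC mE.
  rewrite (eq_bigl (fun u => (X u == X v) && (`|J u - J v| <= D)%N)).
    exact: sum_window_le.
  by move=> u; case: eqP => // /JD ->.
rewrite addrC -lerBlDr; apply: le_trans key.
rewrite -sumrB ler_sum// => u _; rewrite -mulrBr.
have [->|Pu] := eqVneq (P u) 0; first by rewrite !mul0r.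
have Pu0 : 0 < P u by rewrite lt_def Pu P0.
have f0 := freq_gt0 X J Pu0.
rewrite ler_wpM2l// opprK addrC -lnV ?posrE// -lnM ?posrE ?invr_gt0 //.
set y := _ / _; have y0 : 0 < y by rewrite divr_gt0.
have /= := @le_ln1Dx _ (y - 1); rewrite [1 + _]addrC subrK => h.
have : -1 < y - 1 by lra.
move=> /h; lra.
Qed.

End smoothed.

(* [X i v] is the node at level [i] above the leaf [v], [k i] a cell index read off
   that node, and [J i] an index of the next scale, with cells of half the size, read
   off the leaf itself. *)
Lemma tree_entropy_bound (n : nat) (X : nat -> V -> T) (k J : nat -> V -> int)
    (D : nat) (tau : R) : 0 < tau <= 3^-1 ->
  (forall i u v, (i < n)%N -> X i.+1 u = X i.+1 v -> X i u = X i v) ->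
  (forall i u v, (i <= n)%N -> X i u = X i v -> k i u = k i v) ->
  (forall i u v, (i < n)%N -> (`|k i.+1 u - k i.+1 v| <= 5)%N -> (`|k i u - k i v| <= 5)%N) ->
  (forall i v, (i < n)%N -> (`|J i v - k i.+1 v *+ 2| <= 5)%N) ->
  (forall i u v, (i < n)%N -> X i u = X i v -> (`|J i u - J i v| <= D)%N) ->
  exists2 bad : {set V},
    \sum_(v in bad) P v <= expR (- n%:R) + expR (- (tau ^+ 2 * n%:R)) &
    forall v, v \notin bad ->
      near_mass (k n) v *
        expR (\sum_(i < n) class_mean (X i) (fun u => - ln (freq (X i) (J i) u)) v) <=
      expR (n%:R * (2 * tau * ln (2 * D.*2.+1%:R) + ln 11 + 13)).
Proof.
move=> /andP[tau0 tau1] XS Xk kk Jk JD.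
set m : R := D.*2.+1%:R.
have m1 : 1 <= m by rewrite ler1n.
have m0 : 0 < m by exact: lt_le_trans m1.
have B0 : 0 < ln (2 * m) by rewrite ln_gt0//; lra.
pose t := tau / ln (2 * m).
have t0 : 0 < t by rewrite divr_gt0.
have Xle i j u v : (i <= j)%N -> (j <= n)%N -> X j u = X j v -> X i u = X i v.
  move=> ij; elim: j ij => [|j IH]; first by rewrite leqn0 => /eqP ->.
  by rewrite leq_eqVlt => /orP[/eqP -> //|ij] jn /(XS _ _ _ jn); apply: IH => //; exact: ltnW.
pose q i v := freq (X i) (k i.+1) v + m^-1.
have q0 i v : 0 < q i v by rewrite ltr_wpDl ?freq_ge0 ?invr_gt0.
pose h i v := class_mean (X i) (fun w => - log_freq m (X i) (k i.+1) w) v.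
have qX i j u v : (i < j)%N -> (j <= n)%N -> X j u = X j v -> q i u = q i v.
  move=> ij jn e; rewrite /q (@freq_class _ _ u v)//; first exact: Xle (ltnW ij) jn e.
  by apply: Xk; [exact: leq_trans ij jn|exact: Xle jn e].
have hX i j u v : (i <= j)%N -> (j <= n)%N -> X j u = X j v -> h i u = h i v.
  by move=> ij jn e; apply: class_mean_class; exact: Xle jn e.
have near0 i v : 0 <= near_mass (k i) v by exact: sumr_ge0.
(* A supermartingale estimate along the branches: no relation between the product of
   the one-step frequencies and [near_mass] holds pointwise. *)
have E1 j : (j <= n)%N ->
    \sum_v P v * (near_mass (k j) v / \prod_(i < j) q i v) <= 11 ^+ j.
  elim: j => [_|j IH jn].
    rewrite expr0 -[leRHS]P1 ler_sum// => v _.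
    rewrite big_ord0 invr1 mulr1 -[leRHS]mulr1 ler_wpM2l//.
    rewrite -[leRHS]P1 /near_mass [leRHS](bigID (fun u => (`|k 0%N u - k 0%N v| <= 5)%N))/=.
    by rewrite lerDl sumr_ge0.
  rewrite exprS; apply: le_trans (ler_wpM2l _ (IH (ltnW jn))); last by [].
  pose f v := (\prod_(i < j) q i v)^-1.
  rewrite (eq_bigr (fun v => f v * (P v * (near_mass (k j.+1) v / q j v)))); last first.
    by move=> v _; rewrite big_ord_recr/= invfM /f; ring.
  rewrite mulr_sumr (eq_bigr (fun v => f v * (P v * (11 * near_mass (k j) v)))
    (F1 := fun v => 11 * _)); last by move=> v _; rewrite /f; ring.
  apply: (@sum_fibers_le _ _ _ (X j)).
  - by move=> v; rewrite invr_ge0 prodr_ge0// => i _; exact: ltW.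
  - move=> u v e; rewrite /f; congr _^-1; apply: eq_bigr => i _.
    exact: qX (ltn_ord i) (ltnW jn) e.
  - move=> u; apply: near_mass_step; first by rewrite invr_ge0 ltW.
      by move=> ? ?; apply: Xk; exact: ltnW.
    by move=> ? ?; apply: kk.
(* As for [E1], the last factor is peeled off: the earlier ones are constant on the fibres of
   [X j]. *)
have E2 j : (j <= n)%N ->
    \sum_v P v * \prod_(i < j) expR (t * (h i v + ln (q i v))) <= (1 + tau ^+ 2) ^+ j.
  elim: j => [_|j IH jn].
    by rewrite expr0 -[leRHS]P1 ler_sum// => v _; rewrite big_ord0 mulr1.
  rewrite exprS; apply: le_trans (ler_wpM2l _ (IH (ltnW jn))); last first.
    by rewrite addr_ge0// sqr_ge0.
  pose f v := \prod_(i < j) expR (t * (h i v + ln (q i v))).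
  rewrite (eq_bigr (fun v => f v * (P v * expR (t * (h j v + ln (q j v)))))); last first.
    by move=> v _; rewrite big_ord_recr/= /f; ring.
  rewrite mulr_sumr (eq_bigr (fun v => f v * (P v * (1 + tau ^+ 2)))
    (F1 := fun v => (1 + tau ^+ 2) * _)); last by move=> v _; rewrite /f; ring.
  apply: (@sum_fibers_le _ _ _ (X j)).
  - by move=> v; rewrite prodr_ge0// => i _; exact: expR_ge0.
  - move=> u v e; rewrite /f; apply: eq_bigr => i _.
    by rewrite (qX _ _ _ _ (ltn_ord i) (ltnW jn) e) (hX _ _ _ _ (ltnW (ltn_ord i)) (ltnW jn) e).
  - by move=> u; apply: (exp_moment_step m1); rewrite (ltW tau0) tau1.
have markov (f : V -> R) (c E : R) : 0 < c -> (forall v, 0 <= f v) ->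
    \sum_v P v * f v <= E -> \sum_(v | c < f v) P v <= E / c.
  move=> c0 f0 fE; rewrite ler_pdivlMr// mulr_suml; apply: le_trans fE.
  rewrite big_mkcond/= ler_sum// => v _; case: ifPn => [cf|_]; last by rewrite mulr_ge0.
  by rewrite ler_wpM2l// ltW.
pose f1 v := near_mass (k n) v / \prod_(i < n) q i v.
pose f2 v := \prod_(i < n) expR (t * (h i v + ln (q i v))).
(* The thresholds exceed the bounds of [E1] and [E2] by the factors [exp n] and [exp (tau^2 n)],
   using [(1 + tau^2)^n <= exp (tau^2 n)]; these factors are the two exceptional masses given by
   Markov's inequality. *)
pose c1 : R := 11 ^+ n * expR n%:R.
pose c2 : R := expR (2 * tau ^+ 2 * n%:R).
have qq0 v : 0 < \prod_(i < n) q i v by rewrite prodr_gt0.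
exists [set v | (c1 < f1 v) || (c2 < f2 v)].
  apply: (@le_trans _ _ (\sum_(v | c1 < f1 v) P v + \sum_(v | c2 < f2 v) P v)).
    rewrite [leLHS]big_mkcond/= [X in X + _]big_mkcond/= [X in _ + X]big_mkcond/=.
    rewrite -big_split/= ler_sum// => v _; rewrite inE.
    by case: (c1 < f1 v); case: (c2 < f2 v) => //=; rewrite ?addr0 ?add0r ?lerDl.
  rewrite lerD//.
    apply: le_trans (markov f1 c1 _ _ _ (E1 n (leqnn n))) _.
    - by rewrite mulr_gt0 ?expR_gt0 ?exprn_gt0.
    - by move=> v; rewrite divr_ge0 ?near0 ?ltW.
    - by rewrite /c1 invfM mulrA divff ?mul1r ?expRN// expf_neq0.
  apply: le_trans (markov f2 c2 _ _ _ (E2 n (leqnn n))) _.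
  - exact: expR_gt0.
  - by move=> v; rewrite prodr_ge0// => i _; exact: expR_ge0.
  rewrite -expRN; apply: (@le_trans _ _ (expR (tau ^+ 2 * n%:R) * expR (- (2 * tau ^+ 2 * n%:R)))).
    rewrite ler_wpM2r ?expR_ge0// mulrC expRM_natl lerXn2r ?nnegrE ?expR_ge0 ?expR_ge1Dx//.
    by rewrite addr_ge0// sqr_ge0.
  by rewrite -expRD ler_expR; lra.
move=> v; rewrite inE negb_or -!leNgt => /andP[v1 v2].
have {}v1 : near_mass (k n) v <= c1 * \prod_(i < n) q i v by rewrite -ler_pdivrMr.
have qE : \prod_(i < n) q i v = expR (\sum_(i < n) ln (q i v)).
  by rewrite expR_sum; apply: eq_bigr => i _; rewrite lnK// posrE.
have hS : \sum_(i < n) class_mean (X i) (fun u => - ln (freq (X i) (J i) u)) v <=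
    \sum_(i < n) h i v + 12 * n%:R.
  have -> : 12 * n%:R = \sum_(i < n) (12 : R) by rewrite sumr_const card_ord mulr_natr.
  rewrite -big_split/= ler_sum// => i _.
  apply: (@class_entropy_le m m1 _ _ _ D) => //.
    by move=> u; exact: Jk.
  by move=> u w; exact: JD.
(* Dividing the exponent [2 tau^2 n] by [t] produces [2 tau ln(2 m) n]. *)
have {}v2 : \sum_(i < n) h i v + \sum_(i < n) ln (q i v) <= 2 * tau * ln (2 * m) * n%:R.
  move: v2; rewrite /f2 /c2 -expR_sum ler_expR -mulr_sumr big_split/= => v2.
  rewrite -(ler_pM2l t0); apply: le_trans v2 _; rewrite /t.
  by rewrite le_eqVlt; apply/orP; left; apply/eqP; field; rewrite gt_eqF.
apply: (@le_trans _ _ (c1 * \prod_(i < n) q i v * expR (\sum_(i < n) h i v + 12 * n%:R))).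
  apply: ler_pM; [exact: near0|exact: expR_ge0|exact: v1|].
  by rewrite ler_expR.
(* [c1] contributes [ln 11 + 1] per level and [hS] contributes 12, which makes [ln 11 + 13]. *)
have -> : c1 = expR (n%:R * ln 11 + n%:R).
  by rewrite /c1 expRD expRM_natl lnK// posrE.
by rewrite qE -!expRD ler_expR; lra.
Qed.

End finite_tree.

Local Open Scope classical_set_scope.
Local Open Scope ring_scope.

(** * The coding map *)

Section plane.
Variable R : realType.
Implicit Types x y e : 'cV[R]_2.

Lemma enorm_ge0 x : 0 <= enorm x. Proof. exact: sqrtr_ge0. Qed.

Lemma sqr_enorm x : enorm x ^+ 2 = x c0 ord0 ^+ 2 + x c1 ord0 ^+ 2.
Proof. by rewrite sqr_sqrtr// addr_ge0// sqr_ge0. Qed.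

Lemma enormZ (a : R) x : enorm (a *: x) = `|a| * enorm x.
Proof.
rewrite /enorm !mxE !exprMn -mulrDr sqrtrM ?sqr_ge0//.
by rewrite sqrtr_sqr.
Qed.

(** Lagrange's identity: the squares of the two sides differ by the square of the inner product. *)
Lemma pitheta_le e x : `|pitheta e x| <= enorm e * enorm x.
Proof.
rewrite -ler_sqr ?nnegrE ?mulr_ge0 ?enorm_ge0// exprMn !sqr_enorm real_normK ?num_real//.
rewrite /pitheta -subr_ge0.
set a := e _ _; set b := e _ _; set c := x _ _; set d := x _ _.
by rewrite (_ : _ - _ = (a * c + b * d) ^+ 2) ?sqr_ge0//; ring.
Qed.

Lemma pithetaB e x y : pitheta e (x - y) = pitheta e x - pitheta e y.
Proof. by rewrite /pitheta !mxE; ring. Qed.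

Lemma coord_le_enorm x i : `|x i ord0| <= enorm x.
Proof.
rewrite -ler_sqr ?nnegrE ?enorm_ge0// sqr_enorm real_normK ?num_real//.
case: i => -[|[|//]] h.
  by rewrite (_ : Ordinal h = c0) ?lerDl ?sqr_ge0//; exact: val_inj.
by rewrite (_ : Ordinal h = c1) ?lerDr ?sqr_ge0//; exact: val_inj.
Qed.

Lemma enorm_le_coords x : enorm x <= `|x c0 ord0| + `|x c1 ord0|.
Proof.
rewrite -ler_sqr ?nnegrE ?enorm_ge0 ?addr_ge0// sqr_enorm sqrrD !real_normK ?num_real//.
by rewrite addrAC lerDl mulrn_wge0// mulr_ge0.
Qed.

Lemma enormB_le x y : enorm (x - y) <= enorm x + enorm y.
Proof.
rewrite -ler_sqr ?nnegrE ?addr_ge0 ?enorm_ge0// sqrrD !sqr_enorm !mxE.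
have : `|x c0 ord0 * y c0 ord0 + x c1 ord0 * y c1 ord0| <= enorm x * enorm y.
  rewrite -ler_sqr ?nnegrE ?mulr_ge0 ?enorm_ge0// exprMn !sqr_enorm real_normK ?num_real//.
  rewrite -subr_ge0 (_ : _ - _ = (x c0 ord0 * y c1 ord0 - x c1 ord0 * y c0 ord0) ^+ 2).
    exact: sqr_ge0.
  by ring.
by rewrite ler_norml => /andP[h1 h2]; rewrite -mulr_natr; lra.
Qed.

Lemma enorm0 : enorm (0 : 'cV[R]_2) = 0.
Proof. by rewrite /enorm !mxE expr0n/= addr0 sqrtr0. Qed.

Lemma enorm_eq0 x : enorm x = 0 -> x = 0.
Proof.
move=> x0; apply/matrixP => i j; rewrite ord1 mxE.
by apply/eqP; rewrite -normr_le0 -x0 coord_le_enorm.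
Qed.

(** A real [sup] bounds the elements of its set only if an upper bound exists; the sum of the
    absolute values of the entries is one. *)
Lemma opnorm_has_ub (A : 'M[R]_2) :
  has_ubound [set enorm (A *m x) | x in [set x : 'cV[R]_2 | enorm x <= 1]].
Proof.
exists (`|A c0 c0| + `|A c0 c1| + (`|A c1 c0| + `|A c1 c1|)) => _ [x /= x1 <-].
apply: le_trans (enorm_le_coords _) _.
have E i : `|(A *m x) i ord0| <= `|A i c0| + `|A i c1|.
  rewrite mxE big_ord_recl big_ord1 (_ : lift ord0 ord0 = c1); last exact: val_inj.
  apply: le_trans (ler_normD _ _) _; rewrite !normrM.
  by rewrite lerD// -[leRHS]mulr1 ler_wpM2l// (le_trans (coord_le_enorm _ _)).
by rewrite lerD.
Qed.

Lemma enorm_mulmx_le (A : 'M[R]_2) x : enorm (A *m x) <= opnorm A * enorm x.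
Proof.
have [/enorm_eq0 ->|x0] := eqVneq (enorm x) 0.
  by rewrite mulmx0 enorm0 mulr0.
have xp : 0 < enorm x by rewrite lt_def x0 enorm_ge0.
rewrite -ler_pdivrMr//.
have -> : enorm (A *m x) / enorm x = enorm (A *m ((enorm x)^-1 *: x)).
  by rewrite -scalemxAr enormZ mulrC ger0_norm// invr_ge0 ltW.
apply: (ub_le_sup (opnorm_has_ub A)); exists ((enorm x)^-1 *: x) => //=.
by rewrite enormZ ger0_norm ?mulVf ?invr_ge0 ?enorm_ge0.
Qed.

End plane.

Lemma geometric_cauchy_cvg (R : realType) (u : nat -> R) (rho : R) :
  0 <= rho < 1 -> (forall n p, `|u (n + p)%N - u n| <= rho ^+ n) -> cvgn u.
Proof.
move=> /andP[r0 r1] ur; apply: cauchy_cvg; apply: cauchy_exP => eps eps0.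
have /cvgrPdist_lt/(_ _ eps0)[n _ hn] : (fun n => rho ^+ n) @ \oo --> (0 : R).
  by apply: cvg_expr; rewrite ger0_norm.
exists (u n); exists n => // p /= np.
have := ur n (p - n)%N; rewrite subnKC// => /le_lt_trans h.
rewrite /ball/= distrC; apply: h.
by have := hn n (leqnn n); rewrite /= sub0r normrN ger0_norm// exprn_ge0.
Qed.

Section ifs.
Variables (R : realType) (k : nat).
Variables (A : Sym k -> 'M[R]_2) (d : Sym k -> 'cV[R]_2).
Hypothesis hnorm : forall i, opnorm (A i) < 1.
Hypothesis hinv : forall i, Tmap A d i @` @disc R `<=` @disc R.
Implicit Types (a b : Seqs k) (w : seq (Sym k)).

Definition contr_ratio : R := \big[Num.max/0]_(i : Sym k) opnorm (A i).

Lemma contr_ratio_bounds : 0 <= contr_ratio < 1.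
Proof.
apply/andP; split; first exact: bigmax_ge_id.
by apply: bigmax_lt.
Qed.

Lemma Tmap_contr i x y :
  enorm (Tmap A d i x - Tmap A d i y) <= contr_ratio * enorm (x - y).
Proof.
rewrite /Tmap opprD addrACA subrr addr0 -mulmxBr.
apply: le_trans (enorm_mulmx_le _ _) _; rewrite ler_wpM2r ?enorm_ge0//.
exact: (le_bigmax _ (fun i => opnorm (A i))).
Qed.

Lemma Tw_contr w x y :
  enorm (Tw A d w x - Tw A d w y) <= contr_ratio ^+ size w * enorm (x - y).
Proof.
have /andP[r0 _] := contr_ratio_bounds.
elim: w => [|i w IH] /=; first by rewrite mul1r.
apply: le_trans (Tmap_contr _ _ _) _.
by rewrite exprS -mulrA ler_wpM2l.
Qed.

Lemma Tw_disc w x : disc x -> disc (Tw A d w x).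
Proof.
move=> dx; elim: w => [//|i w IH] /=.
by apply: (hinv (i := i)); exists (Tw A d w x).
Qed.

Lemma Tw_cat v w x : Tw A d (v ++ w) x = Tw A d v (Tw A d w x).
Proof. by rewrite /Tw foldr_cat. Qed.

Lemma disc0 : disc (0 : 'cV[R]_2). Proof. by rewrite /disc/= enorm0. Qed.

Lemma Dw_cat v w : Dw A d (v ++ w) `<=` Dw A d v.
Proof.
by move=> _ [x dx <-]; rewrite Tw_cat; exists (Tw A d w x) => //; exact: Tw_disc.
Qed.

Lemma take_prefix a m n : (m <= n)%N -> take m (prefix a n) = prefix a m.
Proof. by move=> mn; rewrite /prefix /mkseq -map_take take_iota (minn_idPl mn). Qed.

Lemma prefix_split a m n : (m <= n)%N -> prefix a n = prefix a m ++ drop m (prefix a n).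
Proof. by move=> mn; rewrite -(take_prefix _ mn) cat_take_drop. Qed.

Lemma prefix_eq_le a b m n : (m <= n)%N -> prefix a n = prefix b n ->
  prefix a m = prefix b m.
Proof. by move=> mn e; rewrite -(take_prefix _ mn) e take_prefix. Qed.

Lemma length_prefix a n : size (prefix a n) = n. Proof. exact: size_mkseq. Qed.

Lemma Dw_prefix_le a m n : (m <= n)%N -> Dw A d (prefix a n) `<=` Dw A d (prefix a m).
Proof. by move=> mn; rewrite (prefix_split a mn); exact: Dw_cat. Qed.

(* The coded point is built as [Z a 0], where [Z a m] codes the [m]-th shift of [a];
   then [Z a 0] lies in every [D_w] because [Z a 0 = T_w (Z a m)]. *)
Let shift a m : Seqs k := fun j => a (m + j)%N.
Let z a m n := Tw A d (prefix (shift a m) n) 0.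

Let z_cvg a m i : cvgn (fun n => z a m n i ord0).
Proof.
apply: (@geometric_cauchy_cvg _ _ contr_ratio); first exact: contr_ratio_bounds.
move=> n p; have np : (n <= n + p)%N by rewrite leq_addr.
rewrite /z (prefix_split _ np) Tw_cat.
set x := Tw _ _ (drop _ _) _.
have -> : forall u v : 'cV[R]_2, u i ord0 - v i ord0 = (u - v) i ord0.
  by move=> u v; rewrite !mxE.
apply: le_trans (coord_le_enorm _ _) _; apply: le_trans (Tw_contr _ _ _) _.
rewrite length_prefix subr0 -[leRHS]mulr1 ler_wpM2l ?exprn_ge0//.
  by have /andP[] := contr_ratio_bounds.
exact: (Tw_disc _ disc0).
Qed.

Let Z a m : 'cV[R]_2 := \col_i limn (fun n => z a m n i ord0).

Let ZE a m i : (fun n => z a m n i ord0) @ \oo --> Z a m i ord0.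
Proof. by rewrite mxE; exact: z_cvg. Qed.

Let z_S a m n : z a m n.+1 = Tmap A d (a m) (z a m.+1 n).
Proof.
rewrite /z /prefix /mkseq /= /shift addn0; congr (Tmap _ _ _ (Tw _ _ _ _)).
rewrite -[1%N]addn0 iotaDl -map_comp; apply: eq_map => j /=.
by rewrite add1n addnS addSn.
Qed.

Let Z_S a m : Z a m = Tmap A d (a m) (Z a m.+1).
Proof.
apply/matrixP => i j; rewrite ord1.
have h1 : (fun n => z a m n.+1 i ord0) @ \oo --> Z a m i ord0.
  by have := @ZE a m i; rewrite -(cvg_shiftS (fun n => z a m n i ord0)).
have h2 : (fun n => z a m n.+1 i ord0) @ \oo --> (Tmap A d (a m) (Z a m.+1)) i ord0.
  rewrite (_ : (fun n => _) = (fun n => A (a m) i c0 * z a m.+1 n c0 ord0 +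
     A (a m) i c1 * z a m.+1 n c1 ord0 + d (a m) i ord0)); last first.
    apply/funext => n; rewrite z_S /Tmap !mxE big_ord_recl big_ord1.
    by rewrite (_ : lift ord0 ord0 = c1)//; exact: val_inj.
  rewrite /Tmap mxE mxE big_ord_recl big_ord1 (_ : lift ord0 ord0 = c1); last exact: val_inj.
  apply: cvgD; last exact: cvg_cst.
  by apply: cvgD; apply: cvgMr; exact: ZE.
exact: (cvg_unique _ h1 h2).
Qed.

Let Z_disc a m : disc (Z a m).
Proof.
rewrite /disc/= -ler_sqr ?nnegrE ?enorm_ge0// sqr_enorm expr1n.
have h : (fun n => z a m n c0 ord0 ^+ 2 + z a m n c1 ord0 ^+ 2) @ \oo -->
    Z a m c0 ord0 ^+ 2 + Z a m c1 ord0 ^+ 2.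
  by apply: cvgD; apply: cvgM; exact: ZE.
rewrite -(cvg_lim _ h)//; apply: limr_le; first by apply/cvg_ex; eexists; exact: h.
apply: nearW => n; rewrite -sqr_enorm -(expr1n _ 2) ler_sqr ?nnegrE ?enorm_ge0//.
exact: (Tw_disc _ disc0).
Qed.

Let Z_Tw a m n : Z a m = Tw A d (prefix (shift a m) n) (Z a (m + n)%N).
Proof.
elim: n m => [|n IH] m; first by rewrite addn0.
rewrite Z_S IH /prefix /mkseq /= /shift addn0 addSnnS; congr (Tmap _ _ _ (Tw _ _ _ _)).
rewrite -[1%N]addn0 iotaDl -map_comp; apply: eq_map => j /=.
by rewrite add1n addnS addSn.
Qed.

(** [coding] is a choice with default value 0, so the content is that the intersection is nonempty;
    [Z a 0] is a point of it. *)
Lemma coding_Dw a n : Dw A d (prefix a n) (coding A d a).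
Proof.
have ne : exists x, forall n, Dw A d (prefix a n) x.
  exists (Z a 0) => p; exists (Z a p); first exact: Z_disc.
  by rewrite (Z_Tw a 0 p).
case: ne => x hx.
exact: (@xgetPex _ 0 [set x | forall n, Dw A d (prefix a n) x] (ex_intro _ x hx)).
Qed.

End ifs.

(** * Projected lengths and stopping times *)

Section projected_length.
Variables (R : realType) (k : nat).
Variables (A : Sym k -> 'M[R]_2) (d : Sym k -> 'cV[R]_2).
Hypothesis hnorm : forall i, opnorm (A i) < 1.
Hypothesis hinv : forall i, Tmap A d i @` @disc R `<=` @disc R.
Variable e : 'cV[R]_2.
Hypothesis he : enorm e = 1.
Implicit Types (a b : Seqs k) (w : seq (Sym k)).
Local Notation rho := (contr_ratio A).

Definition width w : R := fine (plen e (Dw A d w)).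

Let pitheta_Dw w x y : Dw A d w x -> Dw A d w y ->
  `|pitheta e x - pitheta e y| <= 2 * rho ^+ size w.
Proof.
have /andP[r0 _] := contr_ratio_bounds hnorm.
move=> [u du <-] [v dv <-]; rewrite -pithetaB.
apply: le_trans (pitheta_le _ _) _; rewrite he mul1r.
apply: le_trans (Tw_contr d hnorm _ _ _) _; rewrite mulrC ler_wpM2r ?exprn_ge0//.
by apply: le_trans (enormB_le _ _) _; move: du dv; rewrite /disc/=; lra.
Qed.

Let plen_fin w : plen e (Dw A d w) = (width w)%:E.
Proof.
rewrite /width fineK//; rewrite fin_real//; apply/andP; split.
  apply: (@lt_le_trans _ _ 0%E); first exact: ltNy0.
  apply: ereal_sup_ubound; exists (Tw A d w 0, Tw A d w 0).
    by split => /=; exists 0 => //; exact: disc0.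
  by rewrite /= subrr normr0.
apply: (@le_lt_trans _ _ (2 * rho ^+ size w)%:E); last exact: ltry.
by apply: ge_ereal_sup => _ [[x y] [/= hx hy] <-]; rewrite lee_fin pitheta_Dw.
Qed.

Lemma pitheta_Dw_le_width w x y : Dw A d w x -> Dw A d w y ->
  `|pitheta e x - pitheta e y| <= width w.
Proof.
move=> hx hy; rewrite -lee_fin -plen_fin; apply: ereal_sup_ubound.
by exists (x, y).
Qed.

Lemma width_le w : width w <= 2 * rho ^+ size w.
Proof.
rewrite -lee_fin -plen_fin; apply: ge_ereal_sup => _ [[x y] [/= hx hy] <-].
by rewrite lee_fin pitheta_Dw.
Qed.

Lemma width_prefix_le a m n : (m <= n)%N -> width (prefix a n) <= width (prefix a m).
Proof.
move=> mn; rewrite -lee_fin -!plen_fin; apply: ereal_sup_le => _ [[x y] [/= hx hy] <-].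
exists (x, y) => //.
by split => /=; apply: (Dw_prefix_le hinv mn).
Qed.

Lemma width_nil : 2 <= width [::].
Proof.
(* The unit normal to the line and its opposite project to 1 and -1. *)
pose v : 'cV[R]_2 := \col_i (if i == c0 then - e c1 ord0 else e c0 ord0).
have ev : enorm v = 1 by rewrite -he /enorm !mxE/= sqrrN addrC.
have nv : enorm (- v) = 1 by rewrite -ev -scaleN1r enormZ normrN1 mul1r.
have hv : Dw A d [::] v by exists v => //; rewrite /disc/= ev.
have hnv : Dw A d [::] (- v) by exists (- v) => //; rewrite /disc/= nv.
apply: le_trans (pitheta_Dw_le_width hv hnv).
have := sqr_enorm e; rewrite he expr1n /pitheta !mxE/= => h.
rewrite ger0_norm; nra.
Qed.

(** A cell of width 0 has length [+oo], and then both sides are true. *)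
Lemma le_wlen w (n : nat) :
  ((n%:R)%:E <= wlen A d e w)%E = (width w <= 2 * 2^-1 ^+ n).
Proof.
rewrite /wlen -/(width w); case: ifPn => [w0|]; last first.
  rewrite -leNgt leey => w0; apply/esym.
  by rewrite (le_trans w0)// mulr_ge0// exprn_ge0// invr_ge0.
rewrite lee_fin.
have ln2 : 0 < ln 2 :> R by rewrite ln_gt0; lra.
rewrite lerNr ler_pdivrMr//.
rewrite -[LHS]ler_expR lnK ?posrE ?divr_gt0// ler_pdivrMr// mulNr expRN expRM_natl lnK ?posrE//.
by rewrite exprVn mulrC.
Qed.

Section stopping.
Variable N : nat.
Hypothesis N0 : (0 < N)%N.
Definition scale j : R := 2^-1 ^+ (N * j).

Lemma scale_gt0 j : 0 < scale j. Proof. by rewrite exprn_gt0. Qed.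

Lemma scaleS j : scale j = 2 ^+ N * scale j.+1.
Proof. by rewrite /scale mulnS exprD mulrA -exprMn divff ?expr1n ?mul1r. Qed.

(** [nj] is a choice with default value 0. The first time [p] at which the width is at most
    [2 * scale j] satisfies the defining condition, and by monotonicity it is the only one. For
    [0 < j] the empty word is too wide, so [p] is positive and [p.-1] is a strictly earlier time. *)
Let njP a j : (0 < j)%N ->
  let n := nj A d e a N j in
  width (prefix a n) <= 2 * scale j /\
  forall m, width (prefix a m) <= 2 * scale j -> (n <= m)%N.
Proof.
move=> j0 n.
have [m hm] : exists m, width (prefix a m) <= 2 * scale j.
  have := contr_ratio_bounds hnorm => /andP[r0 r1].
  have /cvgrPdist_lt/(_ _ (scale_gt0 j))[m _ hm] : (fun n => rho ^+ n) @ \oo --> (0 : R).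
    by apply: cvg_expr; rewrite ger0_norm.
  exists m; apply: le_trans (width_le _) _; rewrite length_prefix ler_wpM2l//.
  by have := hm m (leqnn m); rewrite /= sub0r normrN ger0_norm ?exprn_ge0// => /ltW.
have ex : exists m, width (prefix a m) <= 2 * scale j by exists m.
have [p hp pmin] := ex_minnP ex.
pose Q := [set n : nat | (wlen A d e (prefix a n.-1) < ((N * j)%:R)%:E)%E /\
                          (((N * j)%:R)%:E <= wlen A d e (prefix a n))%E].
have p0 : (0 < p)%N.
  rewrite lt0n; apply/eqP => p0; move: hp; rewrite p0 => hp.
  have := le_trans width_nil hp; rewrite leNgt => /negP; apply.
  rewrite -[ltRHS]mulr1 ltr_pM2l// exprn_ilt1 ?invr_ge0// -?lt0n ?muln_gt0 ?N0//.
  by rewrite invf_lt1//; lra.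
have Qp : Q p.
  split; last by rewrite le_wlen.
  rewrite ltNge le_wlen; apply/negP => /pmin; lia.
have Qn : Q n by exact: (xgetPex 0%N (ex_intro Q p Qp)).
have -> : n = p.
  apply/eqP; rewrite eqn_leq; apply/andP; split; last by apply: pmin; case: Qn; rewrite le_wlen.
  rewrite leqNgt; apply/negP => pn; case: Qn => + _; rewrite ltNge le_wlen => /negP; apply.
  by apply: le_trans hp; apply: width_prefix_le; lia.
by split => // q; exact: pmin.
Qed.

Definition stop j a := nj A d e a N j.

Lemma width_stop_le a j : (0 < j)%N -> width (prefix a (stop j a)) <= 2 * scale j.
Proof. by move=> j0; have [] := njP a j0. Qed.

Lemma stop_le a j m : (0 < j)%N -> width (prefix a m) <= 2 * scale j -> (stop j a <= m)%N.
Proof. by move=> j0; have [_] := njP a j0; exact. Qed.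

(** The stopping time is decided by the prefix up to it: [b] has stopped by time [stop j a], so its
    own stopped prefix is shared with [a], which gives the converse inequality. *)
Lemma stop_prefix a b j : (0 < j)%N -> prefix b (stop j a) = prefix a (stop j a) ->
  stop j b = stop j a.
Proof.
move=> j0 ab; apply/eqP; rewrite eqn_leq.
have ba : (stop j b <= stop j a)%N by apply: stop_le => //; rewrite ab width_stop_le.
by rewrite ba stop_le// -(prefix_eq_le ba ab) width_stop_le.
Qed.

Lemma stop_mono a j : (0 < j)%N -> (stop j a <= stop j.+1 a)%N.
Proof.
move=> j0; apply: stop_le => //; apply: le_trans (width_stop_le _ _) _ => //.
rewrite ler_wpM2l// (scaleS j) ler_peMl ?(ltW (scale_gt0 _))//.
by rewrite exprn_ege1//; lra.
Qed.

End stopping.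
End projected_length.

(** * Reduction of the entropies to finite sums *)

Lemma measurable_preimage_cball (R : realType) (dsp : measure_display)
    (T : measurableType dsp) (f : T -> R) :
  measurable_fun [set: T] f -> forall x r, measurable [set b | `|f b - x| <= r].
Proof.
move=> mf x r; have mfx : measurable_fun [set: T] (fun b => `|f b - x|).
  by apply: measurableT_comp => //; apply: measurable_funB.
have := mfx measurableT `]-oo, r]%classic (measurable_itv _); rewrite setTI.
by congr measurable; apply/seteqP; split => p /=; rewrite in_itv.
Qed.

Section truncation.
Variable k : nat.
Implicit Types (a b : Seqs k) (w : seq (Sym k)).

Definition trunc M b : M.-tuple (Sym k) := Tuple (introT eqP (length_prefix b M)).

(** Padding with [ord0] lets functions of infinite sequences be evaluated on the finite set of
    tuples, which serve as the leaves of the tree. *)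
Definition extend M (v : M.-tuple (Sym k)) : Seqs k := fun j => nth ord0 v j.

Lemma prefix_extend M (v : M.-tuple (Sym k)) : prefix (extend v) M = v.
Proof. by have := mkseq_nth ord0 v; rewrite size_tuple. Qed.

Lemma prefix_extend_trunc M b m : (m <= M)%N -> prefix (extend (trunc M b)) m = prefix b m.
Proof. by move=> mM; apply: prefix_eq_le mM _; rewrite prefix_extend. Qed.

Lemma cyl_trunc M (v : M.-tuple (Sym k)) b : cyl v b <-> trunc M b = v.
Proof.
rewrite /cyl/= size_tuple; split => [e|<- //]; exact: val_inj.
Qed.

Lemma measurable_cyl w : measurable (cyl w : set (Sigma k)).
Proof. by apply: sub_sigma_algebra; exists w. Qed.

Lemma measurable_trunc dsp (T : sigmaRingType dsp) M (G : M.-tuple (Sym k) -> T) :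
  measurable_fun [set: Sigma k] (fun b : Sigma k => G (trunc M b)).
Proof.
move=> _ Y mY; rewrite setTI.
rewrite (_ : _ @^-1` _ = \bigcup_(v in [set v | Y (G v)]) (cyl v : set (Sigma k))).
  by apply: fin_bigcup_measurable => [|v _]; [exact: finite_finset|exact: measurable_cyl].
apply/seteqP; split => [b /= Yb|b [v /= Yv /cyl_trunc bv] /=].
  by exists (trunc M b) => //; apply/cyl_trunc.
by rewrite bv.
Qed.

Lemma integral_trunc (R : realType) (m : {measure set (Sigma k) -> \bar R}) M
    (G : M.-tuple (Sym k) -> \bar R) : (forall v, (0 <= G v)%E) ->
  (\int[m]_b G (trunc M b) = \sum_(v : M.-tuple (Sym k)) m (cyl v) * G v)%E.
Proof.
move=> G0.
have -> : [set: Sigma k] = \big[setU/set0]_(v : M.-tuple (Sym k)) (cyl v : set (Sigma k)).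
  rewrite -bigcup_seq; apply/esym/seteqP; split => // b _.
  by exists (trunc M b); [rewrite /= mem_index_enum|apply/cyl_trunc].
rewrite ge0_integral_bigsetU//.
- apply: eq_bigr => v _.
  rewrite (eq_integral (cst (G v))); last by move=> b /set_mem /cyl_trunc ->.
  by rewrite integral_cst 1?muleC//; exact: measurable_cyl.
- by move=> v; exact: measurable_cyl.
- exact: index_enum_uniq.
- by move=> u v _ _ [b [/cyl_trunc <- /cyl_trunc <-]].
- by apply: (measurable_funS measurableT) => //; exact: measurable_trunc.
Qed.

(** The bridge to the finite tree: events decided by the first [M] symbols become sums of leaf
    weights. *)
Lemma mu_trunc (R : realType) (mu : probability (Sigma k) R) M (Q : pred (M.-tuple (Sym k))) :
  mu [set b | Q (trunc M b)] = (\sum_(v : M.-tuple (Sym k) | Q v) fine (mu (cyl v)))%:E.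
Proof.
have mQ : measurable [set b : Sigma k | Q (trunc M b)].
  rewrite -[X in measurable X]setTI.
  exact: (@measurable_trunc _ _ M Q measurableT [set true]).
rewrite -[X in mu X]setIT -integral_indic//.
rewrite (_ : (fun b => _) = (fun b : Sigma k => (Q (trunc M b))%:R%:E)); last first.
  apply/funext => b; rewrite indicE; congr (_%:R%:E).
  by case: (boolP (Q _)) => h; [rewrite mem_set|rewrite memNset//=; apply/negP].
rewrite (integral_trunc mu (G := fun v => (Q v)%:R%:E)) => [|v]; last by rewrite lee_fin.
rewrite -sumEFin [RHS]big_mkcond/=; apply: eq_bigr => v _.
case: ifP => _; last by rewrite mule0.
by rewrite mule1 fineK// fin_num_measure//; exact: measurable_cyl.
Qed.

End truncation.

Section projection.
Variables (R : realType) (k : nat).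
Variables (A : Sym k -> 'M[R]_2) (d : Sym k -> 'cV[R]_2).
Hypothesis hnorm : forall i, opnorm (A i) < 1.
Hypothesis hinv : forall i, Tmap A d i @` @disc R `<=` @disc R.
Variable e : 'cV[R]_2.
Hypothesis he : enorm e = 1.

Definition pcoding (b : Sigma k) : R := pitheta e (coding A d b).
(** A representative of the projected cell that depends on the word alone. *)
Definition node w : R := pitheta e (Tw A d w 0).
Local Notation width := (width A d e).

Lemma pcoding_node_dist b n : `|pcoding b - node (prefix b n)| <= width (prefix b n).
Proof.
apply: (pitheta_Dw_le_width hnorm he); first exact: coding_Dw.
by exists 0 => //; exact: disc0.
Qed.

Lemma node_dist b m n : (m <= n)%N ->
  `|node (prefix b n) - node (prefix b m)| <= width (prefix b m).
Proof.
move=> mn; apply: (pitheta_Dw_le_width hnorm he).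
  by apply: (Dw_prefix_le hinv mn); exists 0 => //; exact: disc0.
by exists 0 => //; exact: disc0.
Qed.

(** A pointwise limit of the functions [node (trunc M b)], each constant on the cylinders of length
    [M]. *)
Lemma measurable_pcoding : measurable_fun [set: Sigma k] pcoding.
Proof.
apply: (@measurable_fun_cvg _ _ _ _ (fun M (b : Sigma k) => node (trunc M b) : R)) => [M|b _].
  exact: (@measurable_trunc _ _ _ M (fun v => node v)).
apply/cvgrPdist_le => eps eps0.
have /andP[r0 r1] := contr_ratio_bounds hnorm.
have /cvgrPdist_le/(_ _ eps0) h : (fun n => 2 * contr_ratio A ^+ n) @ \oo --> (0 : R).
  rewrite -(mulr0 2); apply: cvgMr; apply: cvg_expr; by rewrite ger0_norm.
apply: filterS h => n; rewrite sub0r normrN ger0_norm ?mulr_ge0 ?exprn_ge0//.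
apply: le_trans; apply: le_trans (pcoding_node_dist _ _) _.
by apply: le_trans (width_le d hnorm he _) _; rewrite length_prefix.
Qed.

Lemma measurable_ball_mass (mu : probability (Sigma k) R) (W : set (Sigma k))
    (mW : measurable W) r :
  measurable_fun [set: R] (fun x => mu (pcoding @^-1` ball x r `&` W)).
Proof.
(* The mass of a ball is the measure of a section of this measurable subset of the product. *)
pose B : set (R * Sigma k) := [set p | `|p.1 - pcoding p.2| < r].
have mB : measurable B.
  have mf : measurable_fun [set: R * Sigma k] (fun p : R * Sigma k => `|p.1 - pcoding p.2|).
    apply: measurableT_comp => //; apply: measurable_funB => //.
    by apply: measurableT_comp => //; exact: measurable_pcoding.
  have := mf measurableT `]-oo, r[%classic (measurable_itv _); rewrite setTI.
  by rewrite (_ : _ @^-1` _ = B)//; apply/seteqP; split => p /=; rewrite in_itv.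
have := measurable_fun_xsection (mrestr mu mW : {sigma_finite_measure set (Sigma k) -> \bar R}) mB.
apply: eq_measurable_fun => x _ /=; rewrite /mrestr; congr (mu (_ `&` _)).
by apply/seteqP; split => b /=; rewrite /xsection/= inE.
Qed.

(** [condm mu w] is a rescaled restriction of total mass at most 1, zero if the cylinder is null.
    Hence the integrand of the entropy is nonnegative, and the integral can be pulled back to
    [Sigma] and compared there with a function of the truncation. *)
Lemma entropy_condm (mu : probability (Sigma k) R) w r
    (M : nat) (G : M.-tuple (Sym k) -> \bar R) :
  (forall v, (0 <= G v)%E) ->
  (forall b, ((if condm mu w (pcoding @^-1` ball (pcoding b) r) == 0%E then +oo
     else (- ln (fine (condm mu w (pcoding @^-1` ball (pcoding b) r))))%:E) <= G (trunc M b))%E) ->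
  (entropy r (pushforward (condm mu w) pcoding) <=
     \sum_(v : M.-tuple (Sym k)) condm mu w (cyl v) * G v)%E.
Proof.
move=> G0 hG; have mW := measurable_cyl w.
have c0 : 0 <= (fine (mu (cyl w)))^-1 by rewrite invr_ge0 fine_ge0.
have cE : condm mu w = mscale (NngNum c0) (mrestr mu mW).
  by apply/funext => B; rewrite /condm /mscale /mrestr /= muleC.
rewrite cE in hG *.
set m := mscale _ _ in hG *.
have m1 B : measurable B -> (m B <= 1)%E.
  move=> mB; rewrite /m /mscale/= /mrestr.
  have le : (mu (B `&` cyl w) <= mu (cyl w))%E.
    by apply: le_measure; rewrite ?inE//; exact: measurableI.
  have mfin : mu (cyl w) \is a fin_num by exact: fin_num_measure.
  apply: (@le_trans _ _ ((fine (mu (cyl w)))^-1%:E * (fine (mu (cyl w)))%:E)%E).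
    by rewrite lee_wpmul2l ?lee_fin// fineK.
  rewrite -EFinM lee_fin; have [->|n0] := eqVneq (fine (mu (cyl w))) 0.
    by rewrite mulr0.
  by rewrite mulVf.
have mg : measurable_fun [set: R] (fun x => m (pcoding @^-1` ball x r)).
  apply: measurable_funeM; exact: measurable_ball_mass.
have mpre x : measurable (pcoding @^-1` ball x r).
  by rewrite -[X in measurable X]setTI; apply: measurable_pcoding => //; exact: measurable_ball.
pose g x := if m (pcoding @^-1` ball x r) == 0%E then +oo%E
  else (- ln (fine (m (pcoding @^-1` ball x r))))%:E.
have g0 x : (0 <= g x)%E.
  rewrite /g; case: ifP => // _; rewrite lee_fin oppr_ge0 ln_le0//.
  by rewrite -lee_fin fineK ?m1// ge0_fin_numE// (le_lt_trans (m1 _ (mpre x)))// ltry.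
have measg : measurable_fun [set: R] g.
  apply: measurable_fun_ifT => //; first exact: measurable_fun_eqe.
  apply: measurableT_comp => //; apply: measurableT_comp => //.
  by apply: measurableT_comp => //; apply: measurableT_comp => //; exact: fine_measurable.
rewrite /entropy -[X in integral _ _ X]/g ge0_integral_pushforward//.
- rewrite preimage_setT -(integral_trunc m G0); apply: ge0_le_integral => //.
  + by move=> b _; exact: g0.
  + by apply: measurableT_comp => //; exact: measurable_pcoding.
  + exact: measurable_trunc.
  + by move=> b _; exact: hG.
- exact: measurable_pcoding.
- by move=> x _; exact: g0.
Qed.

End projection.

Section floor.
Variable R : realType.
Implicit Types x y : R.

Lemma absz_le (i : int) (n : nat) : (`|i| <= n)%N = (`|i%:~R| <= n%:R :> R).
Proof. by rewrite -intr_norm -[n%:R]/((Posz n)%:~R) ler_int; lia. Qed.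

Lemma absz_lt (i : int) (n : nat) : (`|i| < n)%N = (`|i%:~R| < n%:R :> R).
Proof. by rewrite -intr_norm -[n%:R]/((Posz n)%:~R) ltr_int; lia. Qed.

Lemma floor_bounds x : (Num.floor x)%:~R <= x /\ x < (Num.floor x)%:~R + 1.
Proof. by have /andP[h1 h2] := floor_itv x; rewrite -[1]/(1%:~R) -intrD. Qed.

Lemma floor_dist_le x y (n : nat) : `|x - y| <= n%:R ->
  (`|Num.floor x - Num.floor y| <= n)%N.
Proof.
rewrite ler_norml -ltnS => /andP[h1 h2]; rewrite absz_lt intrB ltr_norml -natr1.
have [] := floor_bounds x; have [] := floor_bounds y => *.
by apply/andP; split; lra.
Qed.

Lemma dist_floor_lt x y (n : nat) : (`|Num.floor x - Num.floor y| <= n)%N ->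
  `|x - y| < n%:R + 1.
Proof.
rewrite absz_le intrB ler_norml => /andP[h1 h2]; rewrite ltr_norml.
have [] := floor_bounds x; have [] := floor_bounds y => *.
by apply/andP; split; lra.
Qed.

End floor.

(** * Stopped words, cells on the line and the mass of balls at typical points *)

Section typical.
Variables (R : realType) (k : nat).
Variables (A : Sym k -> 'M[R]_2) (d : Sym k -> 'cV[R]_2).
Hypothesis hnorm : forall i, opnorm (A i) < 1.
Hypothesis hinv : forall i, Tmap A d i @` @disc R `<=` @disc R.
Variable e : 'cV[R]_2.
Hypothesis he : enorm e = 1.
Variable mu : probability (Sigma k) R.
Variable N : nat.
Hypothesis N3 : (2 < N)%N.
Implicit Types (b : Seqs k).

Let N0 : (0 < N)%N. Proof. exact: leq_trans N3. Qed.

Local Notation stop := (stop A d e N).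
Local Notation scale := (scale R N).
Local Notation pcoding := (pcoding A d e).
Local Notation node := (node A d e).
Local Notation width := (width A d e).

Definition word j b := prefix b (stop j b).
Definition cell j b : int := Num.floor (node (word j b) / scale j).
(* The factor [2] makes two points of one deep cell lie within [scale j] of each
   other even after the error made by truncating at [M]. *)
Definition deep_cell M j b : int := Num.floor (node (prefix b M) / scale j * 2).

Let scale0 j : 0 < scale j. Proof. exact: scale_gt0. Qed.

Let scale8 j : 8 * scale j.+1 <= scale j.
Proof.
rewrite (scaleS R N j) ler_wpM2r ?(ltW (scale0 _))//.
rewrite (_ : 8 = 2 ^+ 3); last by rewrite !exprS expr0; ring.
by rewrite ler_eXn2l//; lra.
Qed.

Let divs (a c : R) j (n : R) : (`|a / scale j - c / scale j| <= n) = (`|a - c| <= n * scale j).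
Proof.
by rewrite -mulrBl normrM (ger0_norm (_ : 0 <= (scale j)^-1)) ?invr_ge0 ?(ltW (scale0 _))// ler_pdivrMr.
Qed.

Lemma pcoding_word_dist j b : (0 < j)%N -> `|pcoding b - node (word j b)| <= 2 * scale j.
Proof.
move=> j0; apply: le_trans (pcoding_node_dist hnorm hinv he _ _) _.
exact: width_stop_le.
Qed.

(** The stopping property makes the cylinders of level [j] disjoint or equal: they are the fibres of
    [word j]. *)
Lemma word_eqP j a b : (0 < j)%N -> cyl (word j a) b <-> word j b = word j a.
Proof.
move=> j0; rewrite /cyl/= length_prefix; split => [ba|ba].
  by rewrite {1}/word (stop_prefix hnorm hinv he N0 j0 ba).
suff <- : stop j b = stop j a by [].
by rewrite -(length_prefix b (stop j b)) -[prefix b _]/(word j b) ba length_prefix.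
Qed.

Lemma word_refine j a b : (0 < j)%N -> word j.+1 a = word j.+1 b -> word j a = word j b.
Proof.
move=> j0 ab; have sab : stop j.+1 a = stop j.+1 b.
  by rewrite -(length_prefix a (stop j.+1 a)) -[prefix a _]/(word j.+1 a) ab length_prefix.
apply/word_eqP => //; rewrite /cyl/= length_prefix.
apply: (prefix_eq_le (stop_mono hnorm hinv he N0 b j0)).
by rewrite -{1}sab; exact: ab.
Qed.

(** The fine nodes are within [6 * scale j.+1], at most [3/4 * scale j] since [8 <= 2^N]; each
    passage to the ancestor costs [2 * scale j], and [4 + 3/4 <= 5]. *)
Lemma cell_coarsen j a b : (0 < j)%N ->
  (`|cell j.+1 a - cell j.+1 b| <= 5)%N -> (`|cell j a - cell j b| <= 5)%N.
Proof.
move=> j0 /(@dist_floor_lt R) h; apply: floor_dist_le.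
rewrite divs.
have {h} h : `|node (word j.+1 a) - node (word j.+1 b)| <= 6 * scale j.+1.
  by rewrite -divs; apply: le_trans (ltW h) _; lra.
have D c : `|node (word j.+1 c) - node (word j c)| <= 2 * scale j.
  apply: le_trans (node_dist hnorm hinv he _ (stop_mono hnorm hinv he N0 _ _)) _ => //.
  exact: width_stop_le.
have := scale8 j; have := D a; have := D b; have := scale0 j.
move: h; rewrite !ler_norml => /andP[? ?] ? /andP[? ?] /andP[? ?] ?.
by apply/andP; split; lra.
Qed.

(** The radius is [2 + 1 + 2]: each point is within [2 * scale j] of its node. *)
Lemma cell_near j a b : (0 < j)%N -> `|pcoding a - pcoding b| <= scale j ->
  (`|cell j a - cell j b| <= 5)%N.
Proof.
move=> j0 h; apply: floor_dist_le; rewrite divs.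
have := pcoding_word_dist a j0; have := pcoding_word_dist b j0.
move: h; rewrite !ler_norml => /andP[? ?] /andP[? ?] /andP[? ?].
by apply/andP; split; lra.
Qed.

Section deep.
Variables (M n : nat).
Hypothesis Mdeep : forall b, width (prefix b M) <= scale n.+1 / 8.

Let scale_le i j : (i <= j)%N -> scale j <= scale i.
Proof.
move=> /subnK <-; elim: (j - i)%N => [//|m IH]; rewrite addSn.
by apply: le_trans IH; have := scale8 (m + i); have := scale0 (m + i).+1; lra.
Qed.

Let width_M j b : (j <= n.+1)%N -> width (prefix b M) <= scale j / 8.
Proof. by move=> jn; apply: le_trans (Mdeep b) _; have := scale_le jn; lra. Qed.

Let stop_M j b : (0 < j)%N -> (j <= n.+1)%N -> (stop j b <= M)%N.
Proof.
move=> j0 jn; apply: stop_le => //; have := width_M b jn; have := scale0 j; lra.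
Qed.

(** At depth [M] all stopping times up to level [n.+1] have occurred, so the padding is not seen. *)
Lemma word_extend_trunc j b : (0 < j)%N -> (j <= n.+1)%N ->
  word j (extend (trunc M b)) = word j b.
Proof.
move=> j0 jn; apply/word_eqP => //; rewrite /cyl/= length_prefix.
by rewrite prefix_extend_trunc ?stop_M.
Qed.

Let node_M_dist j b : (0 < j)%N -> (j <= n.+1)%N ->
  `|node (prefix b M) - node (word j b)| <= 2 * scale j.
Proof.
move=> j0 jn; apply: le_trans (node_dist hnorm hinv he _ (stop_M _ _ _)) _ => //.
exact: width_stop_le.
Qed.

(** The doubled displacement of the nodes is at most 4 and the two roundings add less than 2, so the
    integer is strictly below 6. *)
Lemma deep_cell_cell j b : (0 < j)%N -> (j <= n.+1)%N ->
  (`|deep_cell M j b - cell j b *+ 2| <= 5)%N.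
Proof.
move=> j0 jn; have := node_M_dist b j0 jn; rewrite -divs /deep_cell /cell.
set x := node (prefix b M) / _; set y := node (word j b) / _ => h.
rewrite -ltnS (absz_lt R) intrB mulr2n intrD ltr_norml.
have [] := floor_bounds (x * 2); have [] := floor_bounds y.
move: h; rewrite ler_norml => /andP[] *.
by apply/andP; split; lra.
Qed.

(** Both deep nodes are within [2 * scale j] of the common one, hence [4 * 2^N] units of
    [scale j.+1] apart; halving the cells doubles this count. *)
Lemma deep_cell_word j a b : (0 < j)%N -> (j <= n)%N -> word j a = word j b ->
  (`|deep_cell M j.+1 a - deep_cell M j.+1 b| <= 8 * 2 ^ N)%N.
Proof.
move=> j0 jn ab; apply: floor_dist_le.
have := node_M_dist a j0 (leqW jn); have := node_M_dist b j0 (leqW jn).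
rewrite ab -mulrBl normrM (ger0_norm (_ : 0 <= 2))// => h1 h2.
have : `|node (prefix a M) - node (prefix b M)| <= 4 * 2 ^+ N * scale j.+1.
  rewrite -mulrA -scaleS; move: h1 h2; rewrite !ler_norml => /andP[? ?] /andP[? ?].
  by apply/andP; split; lra.
rewrite -divs natrM natrX; lra.
Qed.

(** Half of [scale j] from the common cell and an eighth from each truncation add up to less than
    [scale j]. *)
Lemma deep_cell_ball j a b : (j <= n.+1)%N -> deep_cell M j a = deep_cell M j b ->
  `|pcoding a - pcoding b| < scale j.
Proof.
move=> jn ab; have h : (`|deep_cell M j a - deep_cell M j b| <= 0)%N by rewrite ab subrr.
have := dist_floor_lt h; rewrite add0r -mulrBl normrM (ger0_norm (_ : 0 <= 2))// -ltr_pdivlMr//.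
rewrite -mulrBl normrM (ger0_norm (_ : 0 <= (scale j)^-1)) ?invr_ge0 ?(ltW (scale0 _))// ltr_pdivrMr// => h2.
have := pcoding_node_dist hnorm hinv he a M; have := pcoding_node_dist hnorm hinv he b M.
have := width_M a jn; have := width_M b jn; have := scale0 j.
move: h2; rewrite !ler_norml !ltr_norml => /andP[? ?] ? ? ? /andP[? ?] /andP[? ?].
by apply/andP; split; lra.
Qed.

Let P (v : M.-tuple (Sym k)) : R := fine (mu (cyl v)).
Let P0 v : 0 <= P v. Proof. exact: fine_ge0. Qed.
Let P1 : \sum_v P v = 1.
Proof.
apply: EFin_inj; rewrite -(mu_trunc mu (fun _ : M.-tuple (Sym k) => true)).
by rewrite (_ : [set b | _] = setT) ?probability_setT//; apply/seteqP.
Qed.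

(** The tree starts at level 0 but stopping times are controlled from level 1 on, hence the shifted
    indices. *)
Let X i (v : M.-tuple (Sym k)) := word i.+1 (extend v).
Let J i (v : M.-tuple (Sym k)) := deep_cell M i.+2 (extend v).

(** The ball of radius [scale i.+2] around a point contains the part of its deep cell coded in the
    cylinder of [w], so its conditional mass is at least the frequency of that cell. *)
Lemma entropy_word_le i b : (i < n)%N ->
  (entropy (2^-1 ^+ (i.+2 * N)) (pushforward (condm mu (word i.+1 b)) pcoding) <=
   (class_mean P (X i) (fun u => - ln (freq P (X i) (J i) u)) (trunc M b))%:E)%E.
Proof.
move=> i_n; rewrite mulnC -/(scale i.+2).
set w := word i.+1 b; set vb := trunc M b.
have Xvb c : X i (trunc M c) = word i.+1 c by rewrite /X word_extend_trunc// ltnS ltnW.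
have Xw (v : M.-tuple (Sym k)) :
    (cyl w `&` cyl v : set (Sigma k)) = if X i v == X i vb then cyl v else set0.
  apply/seteqP; split => [c [/word_eqP cw /cyl_trunc cv]|c].
    by rewrite -cv !Xvb cw// eqxx; apply/cyl_trunc.
  case: eqP => // Xv /cyl_trunc cv; split; last exact/cyl_trunc.
  by apply/word_eqP => //; rewrite -Xvb cv Xv Xvb.
have muw : mu (cyl w) = (class_mass P (X i) vb)%:E.
  rewrite /class_mass -(mu_trunc mu (fun v => X i v == X i vb)); congr (mu _).
  apply/seteqP; split => c /=; rewrite !Xvb.
    by move=> /word_eqP ->.
  by move=> /eqP cw; apply/word_eqP.
have condv (v : M.-tuple (Sym k)) : condm mu w (cyl v) =
    ((if X i v == X i vb then P v else 0) / class_mass P (X i) vb)%:E.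
  rewrite /condm setIC Xw muw/=; case: ifP => _; last by rewrite measure0 mul0e mul0r.
  by rewrite EFinM /P fineK// fin_num_measure//; exact: measurable_cyl.
(* The value [+oo] is harmless: it occurs only outside the cylinder or on leaves of frequency 0,
   which carry no conditional mass. *)
pose G v := if X i v == X i vb then
  (if freq P (X i) (J i) v == 0%R then +oo else (- ln (freq P (X i) (J i) v))%:E)%E else +oo%E.
have fl v := freq_le1 P0 (X i) (J i) v.
have fg v := freq_ge0 P0 (X i) (J i) v.
apply: le_trans (@entropy_condm _ _ _ _ hnorm hinv _ he mu w (scale i.+2) M G _ _) _.
- move=> v; rewrite /G; case: ifP => // _; case: ifP => // _.
  by rewrite lee_fin oppr_ge0 ln_le0.
- move=> c; rewrite /G; case: (X i (trunc M c) =P X i vb) => [cb|_]; last by rewrite leey.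
  case: (eqVneq (freq P (X i) (J i) (trunc M c)) 0) => [_|f0]; first by rewrite leey.
  set p := condm mu w _.
  have mball : measurable (pcoding @^-1` ball (pcoding c) (scale i.+2)).
    rewrite -[X in measurable X]setTI; apply: (measurable_pcoding hnorm hinv he) => //.
    exact: measurable_ball.
  have pge : ((freq P (X i) (J i) (trunc M c))%:E <= p)%E.
    rewrite /p /condm /freq EFinM muw/= /class_mass cb.
    rewrite lee_wpmul2r ?lee_fin ?invr_ge0 ?sumr_ge0//.
    rewrite -(mu_trunc mu (fun v => (X i v == X i vb) && (J i v == J i (trunc M c)))).
    apply: le_measure; rewrite ?inE.
    + rewrite -[X in measurable X]setTI.
      exact: (@measurable_trunc _ _ _ M (fun v => (X i v == X i vb) && (J i v == J i (trunc M c)))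
        measurableT [set true]).
    + by apply: measurableI => //; exact: measurable_cyl.
    + move=> c' /= /andP[/eqP Xc /eqP Jc]; split; last first.
        by apply/word_eqP => //; rewrite -!Xvb.
      rewrite /ball/= distrC; apply: deep_cell_ball => //.
      by move: Jc; rewrite /J /deep_cell !prefix_extend.
  have fp : 0 < freq P (X i) (J i) (trunc M c) by rewrite lt_def f0 fg.
  have p0 : (0 < p)%E by apply: lt_le_trans pge; rewrite lte_fin.
  have pfin : p \is a fin_num.
    rewrite /p /condm fin_numM//; rewrite fin_num_measure//.
    by apply: measurableI => //; exact: measurable_cyl.
  rewrite gt_eqF// lee_fin lerN2 ler_ln ?posrE ?fine_gt0 ?p0/= ?ltey_eq ?pfin//.
  by rewrite -lee_fin fineK.
- rewrite /class_mean mulr_suml -sumEFin [leRHS]big_mkcond/=; apply: lee_sum => v _.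
  rewrite condv /G; case: ifP => _; last by rewrite mul0r mul0e.
  case: ifPn => [/eqP f0|_]; last by rewrite -EFinM mulrAC.
  have -> : P v = 0.
    apply/eqP; rewrite -[_ == _]negbK; apply/negP => Pv.
    by have := freq_gt0 P0 (X i) (J i) (_ : 0 < P v); rewrite f0 ltxx lt_def Pv P0 => /(_ isT).
  by rewrite !mul0r mul0e.
Qed.

(** [tree_entropy_bound] on the tuples of length [M], with [S] the sum of the class means;
    [cell_near] places the ball inside the window measured by [near_mass]. *)
Lemma typical_ball_mass tau : 0 < tau <= 3^-1 ->
  exists2 B : set (Sigma k),
    measurable B /\ (mu B <= (expR (- n%:R) + expR (- (tau ^+ 2 * n%:R)))%:E)%E &
    forall b, ~ B b -> exists2 S : R,
      (\sum_(1 <= i < n.+1) entropy (2^-1 ^+ (i.+1 * N))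
         (pushforward (condm mu (prefix b (nj A d e b N i))) pcoding) <= S%:E)%E &
      (mu [set b' | (`|pcoding b' - pcoding b| <= scale n.+1)%R] <=
        (expR (n%:R * (2 * tau * ln (2 * (8 * 2 ^ N).*2.+1%:R) + ln 11 + 13) - S))%:E)%E.
Proof.
move=> htau.
have [i u v i_n|i u v _|i u v _|i v i_n|i u v i_n|bad Pbad hbad] :=
  @tree_entropy_bound R _ P P0 P1 _ n X (fun i v => cell i.+1 (extend v)) J (8 * 2 ^ N) tau htau.
- exact: word_refine.
- by rewrite /X /cell => ->.
- exact: cell_coarsen.
- exact: deep_cell_cell.
- exact: deep_cell_word.
exists [set b | trunc M b \in bad].
  split; last by rewrite (mu_trunc mu (fun v => v \in bad)) lee_fin.
  rewrite -[X in measurable X]setTI.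
  exact: (@measurable_trunc _ _ _ M (fun v => v \in bad) measurableT [set true]).
move=> b /= /negP /hbad hb.
exists (\sum_(i < n) class_mean P (X i) (fun u => - ln (freq P (X i) (J i) u)) (trunc M b)).
  rewrite big_add1/= big_mkord -sumEFin; apply: lee_sum => i _.
  exact: entropy_word_le.
set S := \sum_(i < n) _ in hb *.
apply: (@le_trans _ _ (near_mass P (fun v => cell n.+1 (extend v)) (trunc M b))%:E).
  rewrite /near_mass -(mu_trunc mu (fun v =>
    (`|cell n.+1 (extend v) - cell n.+1 (extend (trunc M b))| <= 5)%N)).
  apply: le_measure; rewrite ?inE.
  + exact: (measurable_preimage_cball (measurable_pcoding hnorm hinv he)).
  + rewrite -[X in measurable X]setTI.
    exact: (@measurable_trunc _ _ _ M (fun v =>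
      (`|cell n.+1 (extend v) - cell n.+1 (extend (trunc M b))| <= 5)%N) measurableT [set true]).
  + move=> c /= hc; rewrite /cell !word_extend_trunc//.
    exact: cell_near.
by rewrite lee_fin expRB ler_pdivlMr ?expR_gt0.
Qed.

End deep.

Lemma exists_deep n : exists M, forall b, width (prefix b M) <= scale n.+1 / 8.
Proof.
have /andP[r0 r1] := contr_ratio_bounds hnorm.
have eps0 : 0 < scale n.+1 / 16 by rewrite divr_gt0.
have /cvgrPdist_lt/(_ _ eps0)[M _ hM] : (fun n => contr_ratio A ^+ n) @ \oo --> (0 : R).
  by apply: cvg_expr; rewrite ger0_norm.
exists M => b; apply: le_trans (width_le d hnorm he _) _; rewrite length_prefix.
have := hM M (leqnn M); rewrite /= sub0r normrN ger0_norm ?exprn_ge0// => h.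
by lra.
Qed.

End typical.

(** * The mass distribution principle *)

Section mass_distribution.
Context (R : realType) (dsp : measure_display) (T : measurableType dsp).
Variable mu : probability T R.

Lemma negligible_le_eps (N : set T) :
  (forall eps : R, 0 < eps ->
     exists B, [/\ measurable B, (mu B <= eps%:E)%E & N `<=` B]) ->
  mu.-negligible N.
Proof.
move=> h.
have {h} /choice[B hB] : forall n, exists B,
    [/\ measurable B, (mu B <= (n.+1%:R^-1)%:E)%E & N `<=` B].
  by move=> n; apply: h; rewrite invr_gt0.
have mB : measurable (\bigcap_n B n) by apply: bigcapT_measurable => n; case: (hB n).
exists (\bigcap_n B n); split => //; last by move=> x Nx n _; case: (hB n) => _ _; exact.
apply/eqP; rewrite eq_le measure_ge0 andbT; apply/lee_addgt0Pr => eps eps0; rewrite add0e.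
have /cvgrPdist_lt/(_ _ eps0)[n _ hn] := @cvg_harmonic R.
have := hn n (leqnn n); rewrite /= sub0r normrN ger0_norm ?invr_ge0// => /ltW neps.
have [mBn Bn _] := hB n; apply: (@le_trans _ _ (n.+1%:R^-1)%:E); last by rewrite lee_fin.
by apply: le_trans Bn; apply: le_measure; rewrite ?inE//; exact: bigcap_inf.
Qed.

Lemma ediam_ball_sub (F : set R) x r : ediam F = r%:E -> F x ->
  F `<=` [set y | `|y - x| <= r].
Proof.
move=> Fr Fx y Fy /=; rewrite -lee_fin -Fr; apply: ereal_sup_ubound.
by exists (y, x).
Qed.

Lemma ediam_ge0 (F : set R) x : F x -> (0 <= ediam F)%E.
Proof.
move=> Fx; apply: ereal_sup_ubound; exists (x, x) => //=.
by rewrite subrr normr0.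
Qed.

Variable f : T -> R.
Hypothesis mf : measurable_fun [set: T] f.

(** [U] has covers with [s]-sum below [eps / K]; a member meeting [f(E)] lies in a ball centred in
    [f(E)] with its diameter as radius, to which the mass bound applies. *)
Lemma hmeasure0_negligible (K s r0 : R) (E : set T) (U : set R) :
  0 < K -> 0 < r0 ->
  (forall b, E b -> forall r, 0 <= r <= r0 ->
     (mu [set b' | (`|f b' - f b| <= r)%R] <= (K * r `^ s)%:E)%E) ->
  hmeasure s U = 0%E ->
  mu.-negligible (E `&` f @^-1` U).
Proof.
move=> K0 r00 hE hU; apply: negligible_le_eps => eps eps0.
have : (hcontent s r0 U < (eps / K)%:E)%E.
  apply: (@le_lt_trans _ _ 0%E); last by rewrite lte_fin divr_gt0.
  by rewrite -hU; apply: ereal_sup_ubound; exists r0.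
move=> /ereal_inf_lt[_ [F [UF Fr0] <-]] Feps.
pose C j b := [/\ E b & F j (f b)].
(* Closed balls replace the arbitrary sets [F j] to gain measurability. The centre is taken in [E],
   where the mass bound holds; members without such a point are dropped. *)
pose B j : set T := if pselect (exists b, C j b) is left h then
  [set b | `|f b - f (projT1 (cid h))| <= fine (ediam (F j))] else set0.
have mB j : measurable (B j).
  by rewrite /B; case: pselect => // h; exact: (measurable_preimage_cball mf).
have dF j b : F j (f b) -> ediam (F j) = (fine (ediam (F j)))%:E /\ 0 <= fine (ediam (F j)) <= r0.
  move=> Fb; have d0 := ediam_ge0 Fb.
  have dfin : ediam (F j) \is a fin_num.
    by rewrite ge0_fin_numE// (le_lt_trans (Fr0 j))// ltry.
  rewrite fineK//; split => //; rewrite fine_ge0//=.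
  by rewrite -lee_fin fineK.
have muB j : (mu (B j) <= K%:E * cterm s (F j))%E.
  rewrite /B; case: pselect => [h|_]; last first.
    rewrite measure0 mule_ge0 ?lee_fin ?(ltW K0)// /cterm.
    by case: ifP => // _; rewrite lee_fin powR_ge0.
  case: cid => b [Eb Fb] /=; have [_ d0r] := dF _ _ Fb.
  rewrite /cterm; case: asboolP => [F0|_]; first by move: Fb; rewrite F0.
  by rewrite -EFinM; exact: hE.
exists (\bigcup_j B j); split; first exact: bigcupT_measurable.
  apply: le_trans (measure_sigma_subadditive mu mB (bigcupT_measurable _ mB) _) _ => //.
  apply: (@le_trans _ _ (\sum_(0 <= j <oo) K%:E * cterm s (F j))%E).
    by apply: lee_nneseries => *; [exact: measure_ge0|exact: muB].
  rewrite nneseriesZl; last first.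
    by move=> j _; rewrite /cterm; case: ifP => // _; rewrite lee_fin powR_ge0.
  rewrite muleC -lee_pdivlMr// -EFinM; exact: ltW.
move=> b [Eb /UF[j _ Fb]]; exists j => //; rewrite /B; case: pselect => [h|]; last first.
  by move=> nh; exfalso; apply: nh; exists b.
by case: cid => c [Ec Fc] /=; have [+ _] := dF _ _ Fc => /ediam_ball_sub/(_ Fc); apply.
Qed.

Lemma borel_cantelli_geometric (B : nat -> set T) (delta : R) : 0 < delta ->
  (forall n, measurable (B n)) ->
  (forall n, (mu (B n) <= (2 * expR (- (delta * n%:R)))%:E)%E) ->
  {ae mu, forall b, exists n0, forall n, (n0 <= n)%N -> ~ B n b}.
Proof.
move=> d0 mB hB; exists (lim_sup_set B); split.
- by apply: bigcapT_measurable => n; apply: bigcup_measurable.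
- apply: lim_sup_set_cvg0 => //.
  set z := expR (- delta).
  have z0 : 0 < z := expR_gt0 _.
  have z1 : `|z| < 1 by rewrite ger0_norm ?ltW// /z -expR0 ltr_expR oppr_lt0.
  apply: (@le_lt_trans _ _ (2 * (1 - z)^-1)%:E); last exact: ltry.
  apply: lime_le; first exact: is_cvg_nneseries.
  apply: nearW => n.
  apply: (@le_trans _ _ (series (geometric 2 z) n)%:E); last first.
    by rewrite lee_fin; apply: geometric_le_lim.
  rewrite /series/= -sumEFin; apply: lee_sum => i _; apply: le_trans (hB i) _.
  by rewrite lee_fin /z -expRM_natl mulrN [i%:R * _]mulrC.
- move=> b nb n _; apply: contrapT => h; apply: nb; exists n => m nm Bm.
  by apply: h; exists m.
Qed.

End mass_distribution.

(** If [r] lies between scales [n.+2] and [n.+1], the bound at index [n] is off by two steps, which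
    costs [exp(2 c t)] with [c = N ln 2]; then [r^t <= r^s] since [r <= 1]. *)
Lemma powR_bound_of_dyadic (R : realType) (N n0 : nat) (s t : R) (q : R -> \bar R) :
  (0 < N)%N -> 0 <= s -> s < t ->
  (forall x y, x <= y -> (q x <= q y)%E) ->
  (forall n, (n0 <= n)%N -> (q (scale R N n.+1) <= (expR (- (n%:R * (N%:R * ln 2) * t)))%:E)%E) ->
  forall r, 0 <= r <= scale R N n0.+1 ->
    (q r <= (expR (2 * (N%:R * ln 2) * t) * r `^ s)%:E)%E.
Proof.
move=> N0 s0 st qmono hq r /andP[r0 r1].
have t0 : 0 < t by exact: le_lt_trans st.
have ln2 : 0 < ln 2 :> R by rewrite ln_gt0; lra.
have c0 : 0 < N%:R * ln 2 :> R by rewrite mulr_gt0// ltr0n.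
set c : R := N%:R * ln 2 in c0 hq *.
have sE n : scale R N n = expR (- (n%:R * c)).
  rewrite /scale exprVn expRN; congr (_^-1).
  by rewrite /c mulrA -natrM mulnC expRM_natl lnK// posrE.
(* Radius 0 arises from covers by single points; there the mass is 0, being below every
   [exp(- n c t)]. *)
have [r_eq0|rn0] := eqVneq r 0.
  rewrite r_eq0; apply: (@le_trans _ _ 0%E); last by rewrite lee_fin mulr_ge0 ?expR_ge0 ?powR_ge0.
  apply/lee_addgt0Pr => eps eps0; rewrite add0e.
  have ct0 : 0 < c * t by rewrite mulr_gt0.
  pose n := maxn n0 (Num.bound (eps^-1 / (c * t))).
  have hn : eps^-1 < n%:R * (c * t).
    rewrite -ltr_pdivrMr//; apply: lt_le_trans (archi_boundP _) _.
      by rewrite divr_ge0// ?invr_ge0 ltW.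
    by rewrite ler_nat leq_maxr.
  apply: le_trans (qmono 0 (scale R N n.+1) (ltW (scale_gt0 _ _ _))) _.
  apply: le_trans (hq n (leq_maxl _ _)) _; rewrite lee_fin -mulrA expRN.
  rewrite -[leRHS]invrK lef_pV2 ?posrE ?invr_gt0 ?expR_gt0//.
  by apply: le_trans (ltW hn) _; apply: le_trans (expR_ge1Dx _); rewrite lerDr.
have rp : 0 < r by rewrite lt_def rn0.
have ex : exists m, scale R N m < r.
  exists (Num.bound (r^-1 / c)); rewrite sE expRN -[ltRHS]invrK ltf_pV2 ?posrE ?invr_gt0 ?expR_gt0//.
  have : r^-1 < (Num.bound (r^-1 / c))%:R * c.
    by rewrite -ltr_pdivrMr//; apply: archi_boundP; rewrite divr_ge0// ?invr_ge0 ltW.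
  by move=> h; apply: lt_le_trans h _; apply: le_trans (expR_ge1Dx _); rewrite lerDr.
have [m mr mmin] := ex_minnP ex.
have n0m : (n0.+1 < m)%N.
  rewrite ltnNge; apply/negP => mn; move: (lt_le_trans mr r1).
  rewrite !sE ltr_expR ltrN2 ltr_pM2r// ltr_nat; by rewrite ltnNge mn.
case: m mr mmin n0m => [//|[//|n]] mr mmin n0m.
have rn : r <= scale R N n.+1.
  by rewrite leNgt; apply/negP => /mmin; rewrite ltnn.
apply: le_trans (qmono _ _ rn) _; apply: le_trans (hq n n0m) _.
rewrite lee_fin /powR (negbTE rn0) -expRD ler_expR.
have rE : r = expR (ln r) by rewrite lnK// posrE.
move: mr; rewrite sE {1}rE ltr_expR => mr.
have lr : ln r <= 0.
  by apply: ln_le0; apply: le_trans r1 _; rewrite sE -expR0 ler_expR oppr_le0 mulr_ge0// ltW.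
have h1 : t * ln r <= s * ln r by rewrite ler_wnM2r// ltW.
have h2 : t * (- (n.+2%:R * c)) <= t * ln r by rewrite ler_wpM2l// ltW.
by rewrite -[n.+2]addn2 natrD in h2; lra.
Qed.

(** * The theorem *)

Lemma lt_limn_einf (R : realType) (u : nat -> \bar R) (x : \bar R) :
  (x < limn_einf u)%E -> exists n0, forall n, (n0 <= n)%N -> (x < u n)%E.
Proof.
rewrite limn_einf_lim (cvg_lim _ (@cvg_einfs_sup R u))// => /ereal_sup_gt[_ [n0 _ <-] xn0].
exists n0 => n n0n; apply: lt_le_trans xn0 _.
by apply: ereal_inf_lbound; exists n.
Qed.

(** With [tau <= delta / 4] the part of the loss linear in [N] takes at most half of the allowance;
    the constant rest [K] fits in the other half once [N] is large. *)
Lemma entropy_loss_small (R : realType) (delta : R) : 0 < delta ->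
  exists2 tau : R, 0 < tau <= 3^-1 & exists N1, forall N, (N1 <= N)%N ->
    2 * tau * ln (2 * (8 * 2 ^ N).*2.+1%:R) + ln 11 + 13 <= N%:R * ln 2 * delta.
Proof.
move=> d0; exists (Num.min 3^-1 (delta / 4)).
  by rewrite lt_min ge_min lexx invr_gt0 divr_gt0 ?ltr0n.
set tau := Num.min _ _.
have tau0 : 0 < tau by rewrite lt_min invr_gt0 divr_gt0 ?ltr0n.
have taud : tau <= delta / 4 by rewrite ge_min lexx orbT.
have ln2 : 0 < ln 2 :> R by rewrite ln_gt0; lra.
have ln11 : 0 < ln 11 :> R by rewrite ln_gt0; lra.
have dl : 0 < delta * ln 2 by rewrite mulr_gt0.
pose K := 3 * (delta * ln 2) + ln 11 + 13.
have K0 : 0 < K by rewrite /K; lra.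
exists (Num.bound (K / (delta * ln 2 / 2))) => N hN.
have NK : K <= N%:R * (delta * ln 2 / 2).
  rewrite -ler_pdivrMr ?divr_gt0//; apply: le_trans (_ : _ <= (Num.bound (K / (delta * ln 2 / 2)))%:R) _.
    by apply/ltW/archi_boundP; rewrite !divr_ge0 ?ltW.
  by rewrite ler_nat.
have lnb : ln (2 * (8 * 2 ^ N).*2.+1%:R) <= (N%:R + 6) * ln 2 :> R.
  have -> : (N%:R + 6) * ln 2 = ln (2 ^+ (N + 6)) :> R by rewrite lnXn// -[RHS]mulr_natl natrD.
  rewrite ler_ln ?posrE ?mulr_gt0 ?exprn_gt0 ?ltr0n//.
  rewrite -natrM -natrX ler_nat expnD; have := expn_gt0 2 N; lia.
have h1 : tau * ln (2 * (8 * 2 ^ N).*2.+1%:R) <= delta / 4 * ((N%:R + 6) * ln 2).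
  apply: ler_pM => //; first exact: ltW.
  by rewrite ln_ge0// -natrM ler1n; lia.
by rewrite /K in NK; lra.
Qed.

Theorem theorem4p3 (R : realType) (k : nat) (hk : (0 < k)%N)
  (A : Sym k -> 'M[R]_2) (d : Sym k -> 'cV[R]_2)
  (hpos : forall i r c, 0 < A i r c)
  (hnorm : forall i, opnorm (A i) < 1)
  (hinv : forall i, Tmap A d i @` @disc R `<=` @disc R)
  (mu : probability (Sigma k) R) (hmu : bernoulli_measure mu)
  (e : 'cV[R]_2) (he : enorm e = 1) (C : R)
  (hyp : {ae mu, forall a : Sigma k, exists l : \bar R,
           (fun N : nat => limn_einf (fun n : nat => avg_entropy A d mu e a N n))
             @ \oo --> l /\ (C%:E <= l)%E}) :
  (C%:E <= mdim (pushforward mu (fun b : Sigma k => pitheta e (coding A d b))))%E.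
Proof.
apply: le_ereal_inf_tmp => _ [U [mU nuU] <-].
apply: le_ereal_inf_tmp => _ [s [s0 hs] <-].
rewrite lee_fin leNgt; apply/negP => sC.
(* Exponents with [s < s1 < s2 < C]: the mean entropy exceeds [s2], the loss is at most [s2 - s1],
   and the resulting mass exponent [s1] still exceeds [s]. *)
pose s1 := (2 * s + C) / 3; pose s2 := (s + 2 * C) / 3.
have ss1 : s < s1 by rewrite /s1; lra.
have s12 : 0 < s2 - s1 by rewrite /s1 /s2; lra.
have s2C : s2 < C by rewrite /s2; lra.
have [tau htau [N1 hN1]] := entropy_loss_small s12.
have /andP[tau0 tau1] := htau.
have ln2 : 0 < ln 2 :> R by rewrite ln_gt0; lra.
pose f := pcoding A d e.
have mf : measurable_fun [set: Sigma k] f := measurable_pcoding hnorm hinv he.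
(* The suitable [N] depends on the sequence, so all large [N] are treated at once; countably many
   null sets remain null. *)
pose N_ i := (i + N1 + 3)%N.
have N3 i : (2 < N_ i)%N by exact: ltn_addl.
have N0 i : (0 < N_ i)%N by exact: leq_trans (N3 i).
have N_ge i : (i <= N_ i)%N by rewrite /N_ -addnA leq_addr.
have N1_le i : (N1 <= N_ i)%N by rewrite /N_ addnAC leq_addl.
pose cst i : R := 2 * tau * ln (2 * (8 * 2 ^ N_ i).*2.+1%:R) + ln 11 + 13.
pose H i j b : \bar R := entropy (2^-1 ^+ (j.+1 * N_ i))
  (pushforward (condm mu (prefix b (nj A d e b (N_ i) j))) f).
have /choice[B hB] : forall p : nat * nat, exists B : set (Sigma k),
    [/\ measurable B, (mu B <= (expR (- p.2%:R) + expR (- (tau ^+ 2 * p.2%:R)))%:E)%E &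
    forall b, ~ B b -> exists2 S : R, (\sum_(1 <= j < p.2.+1) H p.1 j b <= S%:E)%E &
      (mu [set b' | (`|f b' - f b| <= scale R (N_ p.1) p.2.+1)%R] <=
        (expR (p.2%:R * cst p.1 - S))%:E)%E].
  move=> [i n]; have [M hM] := exists_deep d hnorm he (N_ i) n.
  by have [B [mB muB] hB] := typical_ball_mass hnorm hinv he mu (N3 i) hM htau; exists B.
have bc i : {ae mu, forall b, exists n0, forall n, (n0 <= n)%N -> ~ B (i, n) b}.
  apply: (@borel_cantelli_geometric _ _ _ _ _ (tau ^+ 2)).
  - by rewrite exprn_gt0.
  - by move=> n; have [] := hB (i, n).
  - move=> n; have [_ h _] := hB (i, n); apply: le_trans h _; rewrite lee_fin/=.
    have : expR (- n%:R) <= expR (- (tau ^+ 2 * n%:R)) :> R.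
      rewrite ler_expR lerN2 ler_piMl// expr_le1 ?ltW//; lra.
    lra.
(* Indexing by the threshold [n0] makes the mass bound uniform on each set, as the mass distribution
   principle requires. *)
pose E i n0 : set (Sigma k) := [set b | forall n, (n0 <= n)%N ->
  (mu [set b' | (`|f b' - f b| <= scale R (N_ i) n.+1)%R] <=
     (expR (- (n%:R * ((N_ i)%:R * ln 2) * s1)))%:E)%E].
have Eneg i n0 : mu.-negligible (E i n0 `&` f @^-1` U).
  apply: (@hmeasure0_negligible _ _ _ _ _ mf
    (expR (2 * ((N_ i)%:R * ln 2) * s1)) s (scale R (N_ i) n0.+1)) => //.
  - exact: expR_gt0.
  - exact: scale_gt0.
  - move=> b Eb; apply: (@powR_bound_of_dyadic _ _ _ _ _
      (fun r => mu [set b' | (`|f b' - f b| <= r)%R])) => // x y xy.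
    apply: le_measure; rewrite ?inE; try exact: (measurable_preimage_cball mf).
    by move=> c /= /le_trans; apply.
(* All exceptional sets together are null, yet they will be shown to cover [Sigma], which has mass
   1. *)
pose bad : set (Sigma k) :=
  (~` [set a | exists l : \bar R,
         (fun N : nat => limn_einf (fun n : nat => avg_entropy A d mu e a N n))
           @ \oo --> l /\ (C%:E <= l)%E] `|` f @^-1` (~` U)) `|`
  (\bigcup_i (~` [set b | exists n0, forall n, (n0 <= n)%N -> ~ B (i, n) b]) `|`
   \bigcup_i \bigcup_n0 (E i n0 `&` f @^-1` U)).
have bad0 : mu.-negligible bad.
  apply: negligibleU; apply: negligibleU.
  - exact: hyp.
  - exists (f @^-1` (~` U)); split => //.
    by rewrite -[X in measurable X]setTI; apply: mf => //; exact: measurableC.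
  - by apply: negligible_bigcup => i; exact: bc.
  - by apply: negligible_bigcup => i; apply: negligible_bigcup => n0.
have badT : [set: Sigma k] `<=` bad.
  move=> a _; apply: contrapT => /not_orP[/not_orP[/contrapT[l [ul Cl]] /contrapT Ua]].
  move=> /not_orP[bca aE]; apply: aE.
  have s2l : (s2%:E < l)%E by apply: lt_le_trans Cl; rewrite lte_fin.
  have /ul[i0 _ hi0] : nbhs l [set y | (s2%:E < y)%E] by exact: open_ereal_gt'.
  have /lt_limn_einf[n1 hn1] := hi0 (N_ i0) (N_ge i0).
  have [n2 hn2] : exists n0, forall n, (n0 <= n)%N -> ~ B (i0, n) a.
    by apply: contrapT => h; apply: bca; exists i0.
  (* The successor ensures [0 < n], needed to multiply the average by [n]. *)
  exists i0 => //; exists (maxn n1 n2).+1 => //; split => // n.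
  rewrite gtn_max => /andP[n1n n2n].
  have [_ _ /(_ a (hn2 _ (ltnW n2n)))[S HS muS]] := hB (i0, n).
  apply: le_trans muS _; rewrite lee_fin ler_expR.
  have n0 : 0 < n%:R :> R by rewrite ltr0n (leq_ltn_trans _ n1n).
  have NN : 0 < (N_ i0)%:R * ln 2 :> R by rewrite mulr_gt0// ltr0n.
  have : (s2%:E < ((N_ i0)%:R * ln 2)^-1%:E * (n%:R^-1%:E * S%:E))%E.
    apply: lt_le_trans (hn1 n (ltnW n1n)) _; rewrite /avg_entropy.
    apply: lee_wpmul2l; first by rewrite lee_fin invr_ge0 ltW.
    by apply: lee_wpmul2l; [rewrite lee_fin invr_ge0 ltW|exact: HS].
  rewrite -!EFinM lte_fin !ltr_pdivlMl// => hS.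
  have hc : n%:R * cst i0 <= n%:R * ((N_ i0)%:R * ln 2 * (s2 - s1)).
    by rewrite ler_wpM2l ?(ltW n0)//; exact: hN1.
  by lra.
have : mu [set: Sigma k] = 0%E := measure_negligible measurableT (negligibleS badT bad0).
by rewrite probability_setT => /eqP; rewrite onee_eq0.
Qed.
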